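(* Let $\alpha\neq0$ be real and let $\beta$ be the real number with $\beta^2=1+\alpha^2$ and having the same sign as $\alpha$. The conjugate surface of the catenoid $\mathcal{C}_\alpha$ in $\mathbb{H}^2\times\mathbb{R}$ is the helicoid $\mathcal{H}_\beta$ in $\mathbb{H}^2\times\mathbb{R}$.
   Context: $\mathbb{H}^2=\{(x^0,x^1,x^2): -(x^0)^2+(x^1)^2+(x^2)^2=-1,\ x^0>0\}$ in Lorentz space $\mathbb{L}^3$ with form $-(dx^0)^2+(dx^1)^2+(dx^2)^2$, and $\mathbb{H}^2\times\mathbb{R}\subset\mathbb{L}^3\times\mathbb{R}$. Helicoid $\mathcal{H}_\beta$ ($\beta\ne0$): the surface given by the conformal minimal immersion $$x(u,v)=(\cosh\varphi(u),\ \sinh\varphi(u)\cos\beta v,\ \sinh\varphi(u)\sin\beta v,\ v),$$ where $\varphi'^2=1+\beta^2\sinh^2\varphi$, $\varphi''=\beta^2\sinh\varphi\cosh\varphi$, $\varphi(0)=0$, $\varphi'>0$ (maximal solution, defined on a bounded interval), $v\in\mathbb{R}$, with unit normal $N=\frac{1}{\varphi'(u)}(0,\sin\beta v,-\cos\beta v,\beta\sinh\varphi(u))$. Catenoid $\mathcal{C}_\alpha$ ($\alpha\neq0$): the surface given by the conformal minimal immersion $$x(u,v)=(\cosh\psi(u),\ \sinh\psi(u)\cos\alpha v,\ \sinh\psi(u)\sin\alpha v,\ u),$$ where $1+\psi'^2=\alpha^2\sinh^2\psi$, $\psi''=\alpha^2\sinh\psi\cosh\psi$, $\psi'(0)=0$,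 $\psi>0$ (maximal solution, defined on $(-u_0,u_0)$ with $u_0=\int_1^\infty\frac{dx}{\sqrt{(x^2+\alpha^2)(x^2-1)}}$), $v\in\mathbb{R}$, with unit normal $N=\frac{1}{\alpha\sinh\psi(u)}(-\sinh\psi(u),-\cosh\psi(u)\cos\alpha v,-\cosh\psi(u)\sin\alpha v,\psi'(u))$. In both cases $z=u+iv$ is the conformal coordinate. Conjugation: for a conformal minimal immersion $x:\Sigma\to\mathbb{M}^2\times\mathbb{R}$ ($\mathbb{M}^2=\mathbb{S}^2$ or $\mathbb{H}^2$) of a simply connected Riemann surface with unit normal $N$, let $ds^2$ be the induced metric, $S$ the symmetric operator on $\Sigma$ with $dx(SX)=-\bar\nabla_XN$ ($\bar\nabla$ the connection of $\mathbb{M}^2\times\mathbb{R}$), $T$ the vector field on $\Sigma$ with $dx(T)$ equal to the tangential projection of $\frac{\partial}{\partial t}$ (the unit vector field of the factor $\mathbb{R}$), and $\nu=\langle N,\frac{\partial}{\partial t}\rangle$. Let $J$ be the rotation by $\frac\pi2$ on $T\Sigma$. The conjugate immersion of $x$ is the conformal minimal immersion of $\Sigma$ whose corresponding data are $(ds^2,JS,JT,\nu)$; it is well defined up to isometries of $\mathbb{M}^2\times\mathbb{R}$ preserving the orientations of both $\mathbb{M}^2$ and $\mathbb{R}$, and conjugate surfaces are considered up to such isometries. The surface it parametrizes is the conjugate surface. The unit normals are the ones for which $(dx(e_1),dx(e_2),N)$ is direct for direct frames $(e_1,e_2)$ of $\Sigma$ (the normals given above are of this kind). *)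

(* Defs.v *)
From Stdlib Require Export Reals.
From Coquelicot Require Export Coquelicot.

Open Scope R_scope.

Record L3 : Type := mkL3 { c0 : R; c1 : R; c2 : R }.

Definition add3 (p q : L3) : L3 := mkL3 (c0 p + c0 q) (c1 p + c1 q) (c2 p + c2 q).

Definition scale3 (k : R) (p : L3) : L3 := mkL3 (k * c0 p) (k * c1 p) (k * c2 p).

Definition lorentz (p q : L3) : R := - (c0 p * c0 q) + c1 p * c1 q + c2 p * c2 q.

Definition det3 (p q r : L3) : R :=
  c0 p * (c1 q * c2 r - c2 q * c1 r)
  - c1 p * (c0 q * c2 r - c2 q * c0 r)
  + c2 p * (c0 q * c1 r - c1 q * c0 r).

Definition L3R : Type := (L3 * R)%type.

Definition add (V W : L3R) : L3R := (add3 (fst V) (fst W), snd V + snd W).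

Definition scale (k : R) (V : L3R) : L3R := (scale3 k (fst V), k * snd V).

Definition opp (V : L3R) : L3R := scale (-1) V.

Definition form (V W : L3R) : R := lorentz (fst V) (fst W) + snd V * snd W.

Definition partial_t : L3R := (mkL3 0 0 0, 1).

Definition H2 (p : L3) : Prop := lorentz p p = -1 /\ 0 < c0 p.

(* [V], at a point with H^2-component [p], is tangent to H^2 x R. *)
Definition tangent (p : L3) (V : L3R) : Prop := lorentz (fst V) p = 0.

(* Orthogonal projection onto the tangent space of H^2 x R;
   the sign is due to <p, p> = -1. *)
Definition proj_tangent (p : L3) (V : L3R) : L3R :=
  (add3 (fst V) (scale3 (lorentz (fst V) p) p), snd V).

(* The determinant of (p,0), V1, V2, V3 in L^3 x R, expanded along the last
   coordinate.  A basis X, Y of T_p H^2 is direct when 0 < det3 p X Y, and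
   H^2 x R carries the product orientation, so that a basis V1, V2, V3 of
   its tangent space is direct when this determinant is positive. *)
Definition det_tangent (p : L3) (V1 V2 V3 : L3R) : R :=
  snd V1 * det3 p (fst V2) (fst V3)
  - snd V2 * det3 p (fst V1) (fst V3)
  + snd V3 * det3 p (fst V1) (fst V2).

(* Isometries of H^2 x R preserving the orientations of both factors: a
   direct isometry of H^2, i.e. the restriction of a linear Lorentz
   transformation that preserves H^2 and has determinant 1, times a
   translation (p, t) |-> (A p, t + c). *)
Record direct_isometry_H2 (A : L3 -> L3) : Prop := {
  iso_add : forall p q, A (add3 p q) = add3 (A p) (A q);
  iso_scale : forall k p, A (scale3 k p) = scale3 k (A p);
  iso_lorentz : forall p q, lorentz (A p) (A q) = lorentz p q;
  iso_H2 : forall p, H2 p -> H2 (A p);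
  iso_det : forall p q r, det3 (A p) (A q) (A r) = det3 p q r
}.

Definition isometry (A : L3 -> L3) (c : R) (P : L3R) : L3R := (A (fst P), snd P + c).

Definition isometry_differential (A : L3 -> L3) (V : L3R) : L3R := (A (fst V), snd V).

(* A map on an open set [D] of the plane, with conformal coordinate
   z = u + iv, is represented by a total function of (u, v), whose values
   outside [D] are irrelevant. *)

Definition smooth_on (D : R -> R -> Prop) (f : R -> R -> R) : Prop :=
  forall n u v, D u v -> ex_diff_n f n u v.

Definition smooth_map_on (D : R -> R -> Prop) (x : R -> R -> L3R) : Prop :=
  smooth_on D (fun u v => c0 (fst (x u v))) /\
  smooth_on D (fun u v => c1 (fst (x u v))) /\
  smooth_on D (fun u v => c2 (fst (x u v))) /\
  smooth_on D (fun u v => snd (x u v)).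

Definition velocity (c : R -> L3R) (t : R) : L3R :=
  (mkL3 (Derive (fun s => c0 (fst (c s))) t)
        (Derive (fun s => c1 (fst (c s))) t)
        (Derive (fun s => c2 (fst (c s))) t),
   Derive (fun s => snd (c s)) t).

Definition d_u (x : R -> R -> L3R) (u v : R) : L3R := velocity (fun s => x s v) u.

Definition d_v (x : R -> R -> L3R) (u v : R) : L3R := velocity (fun s => x u s) v.

(* The tangent vector a d/du + b d/dv of the domain is the pair (a, b). *)
Definition differential (x : R -> R -> L3R) (u v : R) (X : R * R) : L3R :=
  add (scale (fst X) (d_u x u v)) (scale (snd X) (d_v x u v)).

(* The covariant derivative, for the Levi-Civita connection of H^2 x R, of a
   tangent field [V] along [x]: the tangential part of the derivative in
   L^3 x R. *)
Definition nabla (x V : R -> R -> L3R) (u v : R) (X : R * R) : L3R :=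
  proj_tangent (fst (x u v)) (differential V u v X).

Record conformal_immersion (D : R -> R -> Prop) (x : R -> R -> L3R) : Prop := {
  ci_smooth : smooth_map_on D x;
  ci_H2 : forall u v, D u v -> H2 (fst (x u v));
  ci_norms : forall u v, D u v ->
    form (d_u x u v) (d_u x u v) = form (d_v x u v) (d_v x u v);
  ci_orthogonal : forall u v, D u v -> form (d_u x u v) (d_v x u v) = 0;
  ci_immersion : forall u v, D u v -> 0 < form (d_u x u v) (d_u x u v)
}.

Record direct_unit_normal (D : R -> R -> Prop) (x N : R -> R -> L3R) : Prop := {
  un_smooth : smooth_map_on D N;
  un_tangent : forall u v, D u v -> tangent (fst (x u v)) (N u v);
  un_normal : forall u v X, D u v -> form (differential x u v X) (N u v) = 0;
  un_unit : forall u v, D u v -> form (N u v) (N u v) = 1;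
  un_direct : forall u v, D u v ->
    0 < det_tangent (fst (x u v)) (d_u x u v) (d_v x u v) (N u v)
}.

(* The quadruple (ds^2, S, T, nu). *)
Record surface_data : Type := mkData {
  metric : R -> R -> R * R -> R * R -> R;
  shape : R -> R -> R * R -> R * R;
  height_field : R -> R -> R * R;
  angle : R -> R -> R
}.

(* [has_shape] determines S on D because dx is injective there, and the
   operator it determines is symmetric.  In [has_height], dx(T) + nu N is the
   decomposition of d/dt into its parts tangent and normal to the surface. *)
Record has_data (D : R -> R -> Prop) (x N : R -> R -> L3R) (d : surface_data)
  : Prop := {
  has_metric : forall u v X Y, D u v ->
    metric d u v X Y = form (differential x u v X) (differential x u v Y);
  has_shape : forall u v X, D u v ->
    differential x u v (shape d u v X) = opp (nabla x N u v X);
  has_angle : forall u v, D u v -> angle d u v = form (N u v) partial_t;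
  has_height : forall u v, D u v ->
    add (differential x u v (height_field d u v)) (scale (angle d u v) (N u v))
    = partial_t
}.

Definition trace (S : R * R -> R * R) : R := fst (S (1, 0)) + snd (S (0, 1)).

Record conformal_minimal_immersion (D : R -> R -> Prop) (x N : R -> R -> L3R)
    (d : surface_data) : Prop := {
  cmi_immersion : conformal_immersion D x;
  cmi_normal : direct_unit_normal D x N;
  cmi_data : has_data D x N d;
  cmi_minimal : forall u v, D u v -> trace (shape d u v) = 0
}.

(* The metric is conformal to du^2 + dv^2, hence the rotation by pi/2 sends
   d/du to d/dv and d/dv to - d/du. *)
Definition J (X : R * R) : R * R := (- snd X, fst X).

Definition conjugate_data (d : surface_data) : surface_data :=
  mkData (metric d)
         (fun u v X => J (shape d u v X))
         (fun u v => J (height_field d u v))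
         (angle d).

Definition conjugate_immersion (D : R -> R -> Prop) (x N x' N' : R -> R -> L3R)
  : Prop :=
  exists d : surface_data,
    conformal_minimal_immersion D x N d /\
    conformal_minimal_immersion D x' N' (conjugate_data d).

Record diffeomorphism (D E : R -> R -> Prop) (h k : R -> R -> R * R) : Prop := {
  diffeo_to : forall u v, D u v -> E (fst (h u v)) (snd (h u v));
  diffeo_from : forall u v, E u v -> D (fst (k u v)) (snd (k u v));
  diffeo_kh : forall u v, D u v -> k (fst (h u v)) (snd (h u v)) = (u, v);
  diffeo_hk : forall u v, E u v -> h (fst (k u v)) (snd (k u v)) = (u, v);
  diffeo_smooth1 : smooth_on D (fun u v => fst (h u v));
  diffeo_smooth2 : smooth_on D (fun u v => snd (h u v));
  diffeo_smooth1' : smooth_on E (fun u v => fst (k u v));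
  diffeo_smooth2' : smooth_on E (fun u v => snd (k u v))
}.

(* [x] on [D] and [y] on [E], with unit normals [N] and [M], parametrize the
   same surface up to an isometry of H^2 x R preserving the orientations of
   both factors. *)
Definition same_surface (D : R -> R -> Prop) (x N : R -> R -> L3R)
    (E : R -> R -> Prop) (y M : R -> R -> L3R) : Prop :=
  exists (h k : R -> R -> R * R) (A : L3 -> L3) (c : R),
    diffeomorphism D E h k /\
    direct_isometry_H2 A /\
    (forall u v, D u v -> y (fst (h u v)) (snd (h u v)) = isometry A c (x u v)) /\
    (forall u v, D u v ->
       M (fst (h u v)) (snd (h u v)) = isometry_differential A (N u v)).

(* The conjugate surface of [x] is the surface parametrized by [y]: a
   conjugate immersion exists, and each one parametrizes that surface. *)
Definition conjugate_surface (D : R -> R -> Prop) (x N : R -> R -> L3R)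
    (E : R -> R -> Prop) (y M : R -> R -> L3R) : Prop :=
  (exists x' N', conjugate_immersion D x N x' N') /\
  (forall x' N', conjugate_immersion D x N x' N' -> same_surface D x' N' E y M).

Definition in_interval (a b : Rbar) (u : R) : Prop := Rbar_lt a u /\ Rbar_lt u b.

Definition strip (a b : Rbar) (u v : R) : Prop := in_interval a b u.

(* [P a b f] says that [f] solves a given problem on the interval (a, b). *)
Definition maximal_solution (P : Rbar -> Rbar -> (R -> R) -> Prop)
    (a b : Rbar) (f : R -> R) : Prop :=
  P a b f /\
  forall (a' b' : Rbar) (g : R -> R),
    P a' b' g -> Rbar_le a' a -> Rbar_le b b' ->
    (forall u, in_interval a b u -> g u = f u) ->
    a' = a /\ b' = b.

Record helicoid_profile (beta : R) (a b : Rbar) (phi : R -> R) : Prop := {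
  hp_interval : in_interval a b 0;
  hp_derivable : forall u, in_interval a b u -> ex_derive phi u;
  hp_first : forall u, in_interval a b u ->
    Derive phi u ^ 2 = 1 + beta ^ 2 * sinh (phi u) ^ 2;
  hp_second : forall u, in_interval a b u ->
    is_derive (Derive phi) u (beta ^ 2 * sinh (phi u) * cosh (phi u));
  hp_initial : phi 0 = 0;
  hp_increasing : forall u, in_interval a b u -> 0 < Derive phi u
}.

Definition helicoid (beta : R) (phi : R -> R) (u v : R) : L3R :=
  (mkL3 (cosh (phi u))
        (sinh (phi u) * cos (beta * v))
        (sinh (phi u) * sin (beta * v)),
   v).

Definition helicoid_normal (beta : R) (phi : R -> R) (u v : R) : L3R :=
  scale (/ Derive phi u)
    (mkL3 0 (sin (beta * v)) (- cos (beta * v)), beta * sinh (phi u)).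

Record catenoid_profile (alpha : R) (a b : Rbar) (psi : R -> R) : Prop := {
  cp_interval : in_interval a b 0;
  cp_derivable : forall u, in_interval a b u -> ex_derive psi u;
  cp_first : forall u, in_interval a b u ->
    1 + Derive psi u ^ 2 = alpha ^ 2 * sinh (psi u) ^ 2;
  cp_second : forall u, in_interval a b u ->
    is_derive (Derive psi) u (alpha ^ 2 * sinh (psi u) * cosh (psi u));
  cp_initial : Derive psi 0 = 0;
  cp_positive : forall u, in_interval a b u -> 0 < psi u
}.

Definition catenoid (alpha : R) (psi : R -> R) (u v : R) : L3R :=
  (mkL3 (cosh (psi u))
        (sinh (psi u) * cos (alpha * v))
        (sinh (psi u) * sin (alpha * v)),
   u).

Definition catenoid_normal (alpha : R) (psi : R -> R) (u v : R) : L3R :=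
  scale (/ (alpha * sinh (psi u)))
    (mkL3 (- sinh (psi u))
          (- (cosh (psi u) * cos (alpha * v)))
          (- (cosh (psi u) * sin (alpha * v))),
     Derive psi u).

(* Main.v *)
From Stdlib Require Import Lra Lia Nsatz.
Require Import Defs.

(* Up to the signs of alpha and beta, the two profiles are related by
   psi' = beta sinh phi,  phi' = alpha sinh psi  and  alpha cosh psi = beta cosh phi:
   each relation turns a solution of one problem into a solution of the other
   on the same interval, so the maximal intervals agree.  With these relations
   the data of H_beta at (u, v) are exactly (ds^2, J S, J T, nu) for C_alpha.

   Conversely, let (x, N) have the data of the helicoid.  The data force the
   R-component of x to be v + const and, with p the H^2-component, make
   (p, p_u / phi', - phi' N) a direct orthonormal frame of L^3 that satisfies a
   linear system with known coefficients.  Undoing a boost of parameter phi(u)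
   and a rotation of angle beta v turns this frame into a constant one, so x is
   the image of the helicoid under a direct isometry. *)

(** * Smooth functions of two variables *)

(** The definition of the conjugate surface speaks of every immersion with the conjugate data, so
    exhibiting the helicoid is not enough: a uniqueness statement of Bonnet type is needed. Here it
    takes no general integrability theory, because the frame system is integrated in closed form.

    The condition beta^2 = 1 + alpha^2 is what makes psi' = beta sinh phi and alpha cosh psi = beta
    cosh phi compatible with both first integrals. The profile problems see only alpha^2 and beta^2;
    the agreement of the signs of alpha and beta enters through the shape operator and the angle.

    Maximality compares a solution only with its own extensions, while the two maximal intervals are
    given independently. They are compared by gluing, done on the helicoid side: phi is strictly
    increasing with a fixed initial value, hence the inverse of an explicit integral, and uniqueness
    follows. A catenoid profile turns at 0, where psi' vanishes, and separation of variables
    degenerates there. *)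

Definition open2 (D : R -> R -> Prop) : Prop :=
  forall u v, D u v -> locally_2d D u v.

(** The order is kept fixed so that closure properties can be proved by induction on it;
    [smooth_on D f] asks for all orders at once. *)
Definition Ck_on (n : nat) (D : R -> R -> Prop) (f : R -> R -> R) : Prop :=
  forall u v, D u v -> ex_diff_n f n u v.

Lemma locally_in_interval (a b : Rbar) (u : R) :
  in_interval a b u -> locally u (in_interval a b).
Proof.
  intros [H1 H2].
  apply filter_and; [ apply (open_Rbar_gt' u a) | apply (open_Rbar_lt' u b) ]; assumption.
Qed.

Lemma open2_strip (a b : Rbar) : open2 (strip a b).
Proof.
  intros u v H; destruct (locally_in_interval a b u H) as [d Hd].
  exists d; intros s t Hs _; apply Hd, Hs.
Qed.


Section Smooth.

Variable D : R -> R -> Prop.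
Hypothesis openD : open2 D.

Lemma Ck_on_ext (n : nat) (f g : R -> R -> R) :
  (forall u v, D u v -> f u v = g u v) -> Ck_on n D f -> Ck_on n D g.
Proof.
  intros E Hf u v H; apply ex_diff_n_ext_loc with f; [ | now apply Hf ].
  destruct (openD u v H) as [d Hd]; exists d; intros s t Hs Ht.
  apply E, Hd; assumption.
Qed.

Lemma Ck_on_le (n m : nat) (f : R -> R -> R) :
  (m <= n)%nat -> Ck_on n D f -> Ck_on m D f.
Proof. intros L Hf u v H; apply (ex_diff_n_m n m L), Hf, H. Qed.

Lemma Ck_on_continuity (n : nat) (f : R -> R -> R) (u v : R) :
  Ck_on n D f -> D u v -> continuity_2d_pt f u v.
Proof. intros Hf H; specialize (Hf u v H); destruct n; apply Hf. Qed.

(** [ex_diff_n] recurses on the functions given by [Derive]. Since D is open, these agree with f1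
    and f2 near each point of D and may be replaced by them. *)
Lemma Ck_on_intro (n : nat) (f f1 f2 : R -> R -> R) :
  (forall u v, D u v -> continuity_2d_pt f u v) ->
  (forall u v, D u v -> is_derive (fun s => f s v) u (f1 u v)) ->
  (forall u v, D u v -> is_derive (fun s => f u s) v (f2 u v)) ->
  Ck_on n D f1 -> Ck_on n D f2 -> Ck_on (S n) D f.
Proof.
  intros Hc H1 H2 K1 K2 u v H; simpl; repeat split.
  - now apply Hc.
  - eexists; apply H1, H.
  - eexists; apply H2, H.
  - apply (Ck_on_ext n f1); trivial.
    intros s t Hst; symmetry; apply is_derive_unique, H1, Hst.
  - apply (Ck_on_ext n f2); trivial.
    intros s t Hst; symmetry; apply is_derive_unique, H2, Hst.
Qed.

Lemma Ck_on_elim (n : nat) (f : R -> R -> R) :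
  Ck_on (S n) D f ->
  exists f1 f2 : R -> R -> R,
    (forall u v, D u v -> is_derive (fun s => f s v) u (f1 u v)) /\
    (forall u v, D u v -> is_derive (fun s => f u s) v (f2 u v)) /\
    Ck_on n D f1 /\ Ck_on n D f2.
Proof.
  intros Hf; do 2 eexists; split; [ | split; [ | split ] ].
  - intros u v H; apply Derive_correct, (Hf u v H).
  - intros u v H; apply (Derive_correct (fun s => f u s)), (Hf u v H).
  - intros u v H; apply (Hf u v H).
  - intros u v H; apply (Hf u v H).
Qed.

Lemma Ck_on_const (n : nat) (c : R) : Ck_on n D (fun _ _ => c).
Proof.
  revert c; induction n as [|n IH]; intros c.
  - intros u v _; split; trivial; apply continuity_2d_pt_const.
  - apply Ck_on_intro with (fun _ _ => 0) (fun _ _ => 0); auto.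
    + intros; apply continuity_2d_pt_const.
    + intros; apply is_derive_Reals, derivable_pt_lim_const.
    + intros; apply is_derive_Reals, derivable_pt_lim_const.
Qed.

Lemma Ck_on_plus (n : nat) (f g : R -> R -> R) :
  Ck_on n D f -> Ck_on n D g -> Ck_on n D (fun u v => f u v + g u v).
Proof.
  revert f g; induction n as [|n IH]; intros f g Hf Hg.
  - intros u v H; split; trivial.
    apply continuity_2d_pt_plus; eapply Ck_on_continuity; eauto.
  - destruct (Ck_on_elim n f Hf) as (f1 & f2 & F1 & F2 & F3 & F4).
    destruct (Ck_on_elim n g Hg) as (g1 & g2 & G1 & G2 & G3 & G4).
    apply Ck_on_intro with (fun u v => f1 u v + g1 u v) (fun u v => f2 u v + g2 u v); auto.
    + intros; apply continuity_2d_pt_plus; eapply Ck_on_continuity; eauto.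
    + intros u v H; apply (is_derive_plus (fun s => f s v) (fun s => g s v)); auto.
    + intros u v H; apply (is_derive_plus (fun s => f u s) (fun s => g u s)); auto.
Qed.

Lemma is_derive_Rmult (f g : R -> R) (x df dg : R) :
  is_derive f x df -> is_derive g x dg ->
  is_derive (fun s => f s * g s) x (df * g x + f x * dg).
Proof. intros; apply (is_derive_mult f g); trivial; apply Rmult_comm. Qed.

Lemma Ck_on_mult (n : nat) (f g : R -> R -> R) :
  Ck_on n D f -> Ck_on n D g -> Ck_on n D (fun u v => f u v * g u v).
Proof.
  revert f g; induction n as [|n IH]; intros f g Hf Hg.
  - intros u v H; split; trivial.
    apply continuity_2d_pt_mult; eapply Ck_on_continuity; eauto.
  - destruct (Ck_on_elim n f Hf) as (f1 & f2 & F1 & F2 & F3 & F4).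
    destruct (Ck_on_elim n g Hg) as (g1 & g2 & G1 & G2 & G3 & G4).
    assert (Hf' : Ck_on n D f) by (apply Ck_on_le with (2 := Hf); lia).
    assert (Hg' : Ck_on n D g) by (apply Ck_on_le with (2 := Hg); lia).
    apply Ck_on_intro with (fun u v => f1 u v * g u v + f u v * g1 u v)
      (fun u v => f2 u v * g u v + f u v * g2 u v).
    + intros; apply continuity_2d_pt_mult; eapply Ck_on_continuity; eauto.
    + intros u v H; apply (is_derive_Rmult (fun s => f s v) (fun s => g s v)); auto.
    + intros u v H; apply (is_derive_Rmult (fun s => f u s) (fun s => g u s)); auto.
    + apply Ck_on_plus; auto.
    + apply Ck_on_plus; auto.
Qed.

(** The function f stays fixed in the induction: the derivative of 1/f is -f' (1/f)^2, which only
    involves the inverse of the same f, at one order less. *)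
Lemma Ck_on_inv (n : nat) (f : R -> R -> R) :
  (forall u v, D u v -> f u v <> 0) ->
  Ck_on n D f -> Ck_on n D (fun u v => / f u v).
Proof.
  intros H0; induction n as [|n IH]; intros Hf.
  - intros u v H; split; trivial.
    apply continuity_2d_pt_inv; auto; eapply Ck_on_continuity; eauto.
  - destruct (Ck_on_elim n f Hf) as (f1 & f2 & F1 & F2 & F3 & F4).
    assert (Hi : Ck_on n D (fun u v => / f u v))
      by (apply IH, Ck_on_le with (2 := Hf); lia).
    apply Ck_on_intro with (fun u v => (-1 * f1 u v) * (/ f u v * / f u v))
      (fun u v => (-1 * f2 u v) * (/ f u v * / f u v)).
    + intros; apply continuity_2d_pt_inv; auto; eapply Ck_on_continuity; eauto.
    + intros u v H.
      replace (-1 * f1 u v * (/ f u v * / f u v)) with (- f1 u v / f u v ^ 2)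
        by (field; auto).
      apply (is_derive_inv (fun s => f s v)); auto.
    + intros u v H.
      replace (-1 * f2 u v * (/ f u v * / f u v)) with (- f2 u v / f u v ^ 2)
        by (field; auto).
      apply (is_derive_inv (fun s => f u s)); auto.
    + repeat apply Ck_on_mult; trivial; apply Ck_on_const.
    + repeat apply Ck_on_mult; trivial; apply Ck_on_const.
Qed.

Lemma Ck_on_fst_intro (n : nat) (f df : R -> R) :
  (forall u v, D u v -> is_derive f u (df u)) ->
  Ck_on n D (fun u _ => df u) -> Ck_on (S n) D (fun u _ => f u).
Proof.
  intros Hf Hd; apply Ck_on_intro with (fun u _ => df u) (fun _ _ => 0); trivial.
  - intros u v H; apply (continuity_1d_2d_pt_comp f (fun u _ => u)).
    + apply continuity_pt_filterlim, (ex_derive_continuous f u); eexists; eauto.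
    + apply continuity_2d_pt_id1.
  - intros; apply is_derive_Reals, derivable_pt_lim_const.
  - apply Ck_on_const.
Qed.

Lemma Ck_on_snd_intro (n : nat) (f df : R -> R) :
  (forall u v, D u v -> is_derive f v (df v)) ->
  Ck_on n D (fun _ v => df v) -> Ck_on (S n) D (fun _ v => f v).
Proof.
  intros Hf Hd; apply Ck_on_intro with (fun _ _ => 0) (fun _ v => df v); trivial.
  - intros u v H; apply (continuity_1d_2d_pt_comp f (fun _ v => v)).
    + apply continuity_pt_filterlim, (ex_derive_continuous f v); eexists; eauto.
    + apply continuity_2d_pt_id2.
  - intros; apply is_derive_Reals, derivable_pt_lim_const.
  - apply Ck_on_const.
Qed.

Lemma smooth_on_ext (f g : R -> R -> R) :
  (forall u v, D u v -> f u v = g u v) -> smooth_on D f -> smooth_on D g.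
Proof. intros E Hf n; apply (Ck_on_ext n f); trivial; exact (Hf n). Qed.

Lemma smooth_on_const (c : R) : smooth_on D (fun _ _ => c).
Proof. intros n; apply Ck_on_const. Qed.

Lemma smooth_on_mult (f g : R -> R -> R) :
  smooth_on D f -> smooth_on D g -> smooth_on D (fun u v => f u v * g u v).
Proof. intros Hf Hg n; apply Ck_on_mult; [ exact (Hf n) | exact (Hg n) ]. Qed.

Lemma smooth_on_opp (f : R -> R -> R) :
  smooth_on D f -> smooth_on D (fun u v => - f u v).
Proof.
  intros Hf; apply smooth_on_ext with (fun u v => -1 * f u v).
  - intros; ring.
  - apply smooth_on_mult; trivial; apply smooth_on_const.
Qed.

Lemma smooth_on_inv (f : R -> R -> R) :
  (forall u v, D u v -> f u v <> 0) ->
  smooth_on D f -> smooth_on D (fun u v => / f u v).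
Proof. intros H0 Hf n; apply Ck_on_inv; trivial; exact (Hf n). Qed.

Lemma smooth_on_fst : smooth_on D (fun u _ => u).
Proof.
  intros n; apply (Ck_on_le (S n)); [ lia | ].
  apply (Ck_on_fst_intro n (fun u => u) (fun _ => 1)).
  - intros; apply is_derive_Reals, derivable_pt_lim_id.
  - apply Ck_on_const.
Qed.

Lemma smooth_on_snd : smooth_on D (fun _ v => v).
Proof.
  intros n; apply (Ck_on_le (S n)); [ lia | ].
  apply (Ck_on_snd_intro n (fun u => u) (fun _ => 1)).
  - intros; apply is_derive_Reals, derivable_pt_lim_id.
  - apply Ck_on_const.
Qed.

(** The derivative of each function is a multiple of the other, so both go through one induction. *)
Lemma smooth_on_trig (k : R) :
  smooth_on D (fun _ v => cos (k * v)) /\ smooth_on D (fun _ v => sin (k * v)).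
Proof.
  enough (H : forall n, Ck_on n D (fun _ v => cos (k * v)) /\
                        Ck_on n D (fun _ v => sin (k * v)))
    by (split; intros n; apply H).
  induction n as [|n [IHc IHs]]; [ split | ].
  - apply (Ck_on_le 1); [ lia | ].
    apply (Ck_on_snd_intro 0 (fun v => cos (k * v)) (fun v => - (k * sin (k * v)))).
    + intros; auto_derive; trivial; ring.
    + intros u v _; split; trivial.
      apply continuity_2d_pt_opp, continuity_2d_pt_mult.
      * apply continuity_2d_pt_const.
      * apply (continuity_1d_2d_pt_comp (fun v => sin (k * v)) (fun _ v => v));
          [ reg | apply continuity_2d_pt_id2 ].
  - apply (Ck_on_le 1); [ lia | ].
    apply (Ck_on_snd_intro 0 (fun v => sin (k * v)) (fun v => k * cos (k * v))).
    + intros; auto_derive; trivial; ring.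
    + intros u v _; split; trivial.
      apply continuity_2d_pt_mult.
      * apply continuity_2d_pt_const.
      * apply (continuity_1d_2d_pt_comp (fun v => cos (k * v)) (fun _ v => v));
          [ reg | apply continuity_2d_pt_id2 ].
  - split.
    + apply (Ck_on_snd_intro n (fun v => cos (k * v)) (fun v => (- k) * sin (k * v))).
      * intros; auto_derive; trivial; ring.
      * apply Ck_on_mult; trivial; apply Ck_on_const.
    + apply (Ck_on_snd_intro n (fun v => sin (k * v)) (fun v => k * cos (k * v))).
      * intros; auto_derive; trivial; ring.
      * apply Ck_on_mult; trivial; apply Ck_on_const.
Qed.

End Smooth.

Lemma is_derive_sinh_comp (f : R -> R) (x df : R) :
  is_derive f x df -> is_derive (fun s => sinh (f s)) x (df * cosh (f x)).
Proof.
  intros; apply (is_derive_comp sinh f); trivial.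
  apply is_derive_Reals, derivable_pt_lim_sinh.
Qed.

Lemma is_derive_cosh_comp (f : R -> R) (x df : R) :
  is_derive f x df -> is_derive (fun s => cosh (f s)) x (df * sinh (f x)).
Proof.
  intros; apply (is_derive_comp cosh f); trivial.
  apply is_derive_Reals, derivable_pt_lim_cosh.
Qed.

(* Both profiles satisfy f'' = k^2 sinh f cosh f. *)
Lemma smooth_on_profile (k : R) (a b : Rbar) (f : R -> R) :
  (forall u, in_interval a b u -> ex_derive f u) ->
  (forall u, in_interval a b u ->
     is_derive (Derive f) u (k ^ 2 * sinh (f u) * cosh (f u))) ->
  smooth_on (strip a b) (fun u _ => sinh (f u)) /\
  smooth_on (strip a b) (fun u _ => cosh (f u)) /\
  smooth_on (strip a b) (fun u _ => Derive f u).
Proof.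
  intros H1 H2; assert (Do := open2_strip a b).
  assert (D1 : forall u, in_interval a b u -> is_derive f u (Derive f u))
    by (intros; apply Derive_correct; auto).
  assert (Cf : forall u v, strip a b u v -> continuity_2d_pt (fun u _ => f u) u v).
  { intros u v H; apply (continuity_1d_2d_pt_comp f (fun u _ => u)).
    - apply continuity_pt_filterlim, (ex_derive_continuous f u), H1, H.
    - apply continuity_2d_pt_id1. }
  (* By the second-order equation, the derivatives of sinh f, cosh f and f' are polynomials in these
     same three functions, which permits a simultaneous induction. *)
  enough (H : forall n, Ck_on n (strip a b) (fun u _ => sinh (f u)) /\
                        Ck_on n (strip a b) (fun u _ => cosh (f u)) /\
                        Ck_on n (strip a b) (fun u _ => Derive f u))
    by (split; [ | split ]; intros n; apply H).
  induction n as [|n (IHs & IHc & IHd)].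
  - split; [ | split ]; intros u v H; split; trivial.
    + apply (continuity_1d_2d_pt_comp sinh (fun u _ => f u)); auto.
      apply derivable_continuous, derivable_sinh.
    + apply (continuity_1d_2d_pt_comp cosh (fun u _ => f u)); auto.
      apply derivable_continuous, derivable_cosh.
    + apply (continuity_1d_2d_pt_comp (Derive f) (fun u _ => u)).
      * apply continuity_pt_filterlim, (ex_derive_continuous (Derive f) u).
        eexists; apply H2, H.
      * apply continuity_2d_pt_id1.
  - split; [ | split ].
    + apply (Ck_on_fst_intro _ Do n (fun u => sinh (f u))
               (fun u => Derive f u * cosh (f u))).
      * intros u v H; apply is_derive_sinh_comp, D1, H.
      * apply Ck_on_mult; trivial.
    + apply (Ck_on_fst_intro _ Do n (fun u => cosh (f u))
               (fun u => Derive f u * sinh (f u))).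
      * intros u v H; apply is_derive_cosh_comp, D1, H.
      * apply Ck_on_mult; trivial.
    + apply (Ck_on_fst_intro _ Do n (Derive f)
               (fun u => k ^ 2 * sinh (f u) * cosh (f u))).
      * intros u v H; apply H2, H.
      * apply (Ck_on_mult _ Do); [ apply (Ck_on_mult _ Do) | ]; trivial.
        apply Ck_on_const; trivial.
Qed.

(** * The two profiles *)

Lemma cosh_sqr (x : R) : cosh x ^ 2 = 1 + sinh x ^ 2.
Proof.
  unfold cosh, sinh; assert (H := exp_plus x (- x)).
  replace (x + - x) with 0 in H by ring; rewrite exp_0 in H.
  apply Rminus_diag_uniq; transitivity (exp x * exp (- x) - 1); [ field | lra ].
Qed.

Lemma cosh_pos (x : R) : 0 < cosh x.
Proof. unfold cosh; generalize (exp_pos x) (exp_pos (- x)); lra. Qed.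

Lemma sinh_pos (x : R) : 0 < x -> 0 < sinh x.
Proof. intros; rewrite <- sinh_0; now apply sinh_lt. Qed.

(** The derivative is written with cosh (arcsinh y) in place of sqrt (y^2 + 1), the form in which
    the relation between cosh phi and cosh psi applies. *)
Lemma is_derive_arcsinh_comp (f : R -> R) (x df : R) :
  is_derive f x df ->
  is_derive (fun s => arcsinh (f s)) x (df / cosh (arcsinh (f x))).
Proof.
  intros H; apply (is_derive_comp arcsinh f); trivial.
  apply is_derive_Reals.
  replace (/ cosh (arcsinh (f x))) with (/ sqrt (f x ^ 2 + 1)).
  - apply derivable_pt_lim_arcsinh.
  - f_equal; rewrite <- (sqrt_pow2 (cosh _)) by apply Rlt_le, cosh_pos.
    f_equal; rewrite cosh_sqr, sinh_arcsinh; ring.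
Qed.

Lemma is_derive_Rdiv_const (f : R -> R) (x df k : R) :
  is_derive f x df -> is_derive (fun s => f s / k) x (df / k).
Proof.
  intros H; replace (df / k) with (df * / k + f x * 0) by (unfold Rdiv; ring).
  apply (is_derive_Rmult f (fun _ => / k)); trivial.
  apply is_derive_Reals, derivable_pt_lim_const.
Qed.

Lemma in_interval_convex (a b : Rbar) (u v t : R) :
  in_interval a b u -> in_interval a b v -> u <= t <= v -> in_interval a b t.
Proof.
  intros [H1 _] [_ H2] [H3 H4]; split.
  - apply Rbar_lt_le_trans with u; trivial.
  - apply Rbar_le_lt_trans with v; trivial.
Qed.

Lemma constant_on_interval (a b : Rbar) (f : R -> R) :
  (forall t, in_interval a b t -> is_derive f t 0) ->
  forall u v, in_interval a b u -> in_interval a b v -> f u = f v.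
Proof.
  intros Hf.
  assert (W : forall u v, in_interval a b u -> in_interval a b v -> u < v -> f u = f v).
  { intros u v Hu Hv L; apply eq_is_derive; trivial.
    intros t Ht; apply Hf, (in_interval_convex a b u v); trivial. }
  intros u v Hu Hv; destruct (Rtotal_order u v) as [L | [-> | L]]; auto.
  symmetry; auto.
Qed.

(* Time needed to climb from height 0 to height y, the inverse function of a
   helicoid profile. *)
Definition climb_time (beta y : R) : R :=
  RInt (fun s => / sqrt (1 + beta ^ 2 * sinh s ^ 2)) 0 y.

Lemma is_derive_climb_time (beta y : R) :
  is_derive (climb_time beta) y (/ sqrt (1 + beta ^ 2 * sinh y ^ 2)).
Proof.
  assert (C : forall s, continuous (fun s => / sqrt (1 + beta ^ 2 * sinh s ^ 2)) s).
  { intros s; apply (ex_derive_continuous (fun s => / sqrt (1 + beta ^ 2 * sinh s ^ 2))).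
    assert (P : 0 < 1 + beta ^ 2 * sinh s ^ 2)
      by (generalize (pow2_ge_0 (beta * sinh s)); rewrite Rpow_mult_distr; lra).
    auto_derive; repeat split; trivial.
    apply Rgt_not_eq, sqrt_lt_R0, P. }
  apply (is_derive_RInt (fun s => / sqrt (1 + beta ^ 2 * sinh s ^ 2)) _ 0); trivial.
  apply filter_forall; intros t; apply (RInt_correct (V := R_CompleteNormedModule)).
  apply (ex_RInt_continuous (V := R_CompleteNormedModule)); auto.
Qed.

Lemma climb_time_inj (beta y z : R) : climb_time beta y = climb_time beta z -> y = z.
Proof.
  intros E.
  destruct (MVT_gen (climb_time beta) y z (fun s => / sqrt (1 + beta ^ 2 * sinh s ^ 2)))
    as (s & _ & Hs).
  - intros; apply is_derive_climb_time.
  - intros; apply continuity_pt_filterlim, (ex_derive_continuous (climb_time beta)).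
    eexists; apply is_derive_climb_time.
  - assert (P : 0 < / sqrt (1 + beta ^ 2 * sinh s ^ 2)).
    { apply Rinv_0_lt_compat, sqrt_lt_R0.
      generalize (pow2_ge_0 (beta * sinh s)); rewrite Rpow_mult_distr; lra. }
    assert (Z : (/ sqrt (1 + beta ^ 2 * sinh s ^ 2)) * (z - y) = 0) by lra.
    destruct (Rmult_integral _ _ Z); lra.
Qed.

(** Separation of variables: phi' > 0 selects the positive root in the first-order equation, so
    [climb_time] composed with phi has derivative 1. *)
Lemma climb_time_profile (beta : R) (a b : Rbar) (phi : R -> R) :
  helicoid_profile beta a b phi ->
  forall u, in_interval a b u -> climb_time beta (phi u) = u.
Proof.
  intros P u Hu.
  enough (E : climb_time beta (phi u) - u = climb_time beta (phi 0) - 0).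
  { rewrite (hp_initial _ _ _ _ P) in E; unfold climb_time in E at 2.
    rewrite RInt_point in E; unfold zero in E; simpl in E; lra. }
  apply (constant_on_interval a b (fun u => climb_time beta (phi u) - u)); trivial;
    [ | apply P ].
  clear u Hu; intros u Hu.
  assert (L := hp_increasing _ _ _ _ P u Hu).
  replace 0 with (Derive phi u * / sqrt (1 + beta ^ 2 * sinh (phi u) ^ 2) - 1).
  - apply (is_derive_minus (fun u => climb_time beta (phi u)) (fun u => u)).
    + apply (is_derive_comp (climb_time beta) phi).
      * apply is_derive_climb_time.
      * apply Derive_correct, (hp_derivable _ _ _ _ P u Hu).
    + apply is_derive_Reals, derivable_pt_lim_id.
  - rewrite <- (hp_first _ _ _ _ P u Hu), sqrt_pow2 by lra; field; lra.
Qed.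

(** Both values have climb time u, and [climb_time] is injective. *)
Lemma helicoid_profile_unique (beta : R) (a b c d : Rbar) (phi chi : R -> R) :
  helicoid_profile beta a b phi -> helicoid_profile beta c d chi ->
  forall u, in_interval a b u -> in_interval c d u -> phi u = chi u.
Proof.
  intros P Q u Hu Hu'; apply (climb_time_inj beta).
  rewrite (climb_time_profile _ _ _ _ P), (climb_time_profile _ _ _ _ Q); trivial.
Qed.

Lemma helicoid_profile_sqr (beta k : R) (a b : Rbar) (phi : R -> R) :
  beta ^ 2 = k ^ 2 -> helicoid_profile beta a b phi -> helicoid_profile k a b phi.
Proof. intros E []; split; rewrite <- ?E; trivial. Qed.

Lemma catenoid_profile_sqr (alpha k : R) (a b : Rbar) (psi : R -> R) :
  alpha ^ 2 = k ^ 2 -> catenoid_profile alpha a b psi -> catenoid_profile k a b psi.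
Proof. intros E []; split; rewrite <- ?E; trivial. Qed.

(** A common extension is what allows maximality to be applied to solutions on unrelated intervals.
    The intervals meet at 0, so their union is an interval; the solutions agree on the overlap, and
    every condition other than the initial value is local. *)
Lemma helicoid_profile_glue (beta : R) (a b c d : Rbar) (phi chi : R -> R) :
  helicoid_profile beta a b phi -> helicoid_profile beta c d chi ->
  exists (a' b' : Rbar) (f : R -> R),
    helicoid_profile beta a' b' f /\
    Rbar_le a' a /\ Rbar_le b b' /\ Rbar_le a' c /\ Rbar_le d b' /\
    forall u, in_interval a b u -> f u = phi u.
Proof.
  intros P Q.
  assert (U := helicoid_profile_unique beta a b c d phi chi P Q).
  set (a' := if Rbar_le_dec a c then a else c).
  set (b' := if Rbar_le_dec b d then d else b).
  set (f := fun u : R => if Rbar_lt_dec a u then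
                           if Rbar_lt_dec u b then phi u else chi u else chi u).
  assert (Fp : forall u, in_interval a b u -> f u = phi u).
  { intros u [H1 H2]; unfold f.
    destruct (Rbar_lt_dec a u); [ destruct (Rbar_lt_dec u b) | ]; easy. }
  assert (Fc : forall u, in_interval c d u -> f u = chi u).
  { intros u Hu; unfold f.
    destruct (Rbar_lt_dec a u); [ destruct (Rbar_lt_dec u b) | ]; trivial.
    apply U; [ split | ]; trivial. }
  destruct (hp_interval _ _ _ _ P) as [P1 P2].
  destruct (hp_interval _ _ _ _ Q) as [Q1 Q2].
  assert (I : forall u, in_interval a' b' u -> in_interval a b u \/ in_interval c d u).
  { intros u [H1 H2]; unfold a', b' in H1, H2.
    (* The endpoints a' and b' may come from different intervals. For u <= 0 the interval that
       supplies a' contains u, since it extends beyond 0; for u > 0 it is the one that supplies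
       b'. *)
    destruct (Rle_lt_dec u 0) as [L | L].
    - destruct (Rbar_le_dec a c); [ left | right ]; split; trivial;
        apply Rbar_le_lt_trans with 0; trivial.
    - destruct (Rbar_le_dec b d); [ right | left ]; split; trivial;
        apply Rbar_lt_trans with 0; trivial. }
  assert (Local : forall u, in_interval a' b' u ->
            exists (g : R -> R) (p q : Rbar),
              helicoid_profile beta p q g /\ in_interval p q u /\
              forall t, in_interval p q t -> g t = f t).
  { intros u Hu; destruct (I u Hu) as [H | H].
    - exists phi, a, b; split; [ | split ]; trivial; intros; symmetry; auto.
    - exists chi, c, d; split; [ | split ]; trivial; intros; symmetry; auto. }
  assert (Dloc : forall (g : R -> R) (p q : Rbar),
            (forall t, in_interval p q t -> g t = f t) ->
            forall t, in_interval p q t -> Derive g t = Derive f t).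
  { intros g p q E t Ht; apply Derive_ext_loc.
    apply (filter_imp (in_interval p q)); trivial.
    apply locally_in_interval, Ht. }
  exists a', b', f.
  refine (conj _ (conj _ (conj _ (conj _ (conj _ Fp))))); [ split | | | | ].
  - unfold a', b'; split.
    + destruct (Rbar_le_dec a c); trivial.
    + destruct (Rbar_le_dec b d); trivial.
  - intros u Hu; destruct (Local u Hu) as (g & p & q & G & Hg & E).
    apply (ex_derive_ext_loc g); [ | now apply (hp_derivable _ _ _ _ G) ].
    apply (filter_imp (in_interval p q)); trivial; apply locally_in_interval, Hg.
  - intros u Hu; destruct (Local u Hu) as (g & p & q & G & Hg & E).
    rewrite <- (Dloc g p q), <- (E u); trivial; now apply (hp_first _ _ _ _ G).
  - intros u Hu; destruct (Local u Hu) as (g & p & q & G & Hg & E).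
    rewrite <- (E u) by trivial.
    apply (is_derive_ext_loc (Derive g)); [ | now apply (hp_second _ _ _ _ G) ].
    apply (filter_imp (in_interval p q)); [ now apply Dloc | ].
    apply locally_in_interval, Hg.
  - rewrite Fp by (split; trivial); apply P.
  - intros u Hu; destruct (Local u Hu) as (g & p & q & G & Hg & E).
    rewrite <- (Dloc g p q); trivial; now apply (hp_increasing _ _ _ _ G).
  - unfold a'; destruct (Rbar_le_dec a c); [ apply Rbar_le_refl | ].
    apply Rbar_lt_le, Rbar_not_le_lt; trivial.
  - unfold b'; destruct (Rbar_le_dec b d); [ trivial | apply Rbar_le_refl ].
  - unfold a'; destruct (Rbar_le_dec a c); [ trivial | apply Rbar_le_refl ].
  - unfold b'; destruct (Rbar_le_dec b d); [ apply Rbar_le_refl | ].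
    apply Rbar_lt_le, Rbar_not_le_lt; trivial.
Qed.

(** The candidate solves psi' = beta sinh phi for phi. Differentiating this relation gives psi'' =
    phi' beta cosh phi; with psi'' = alpha^2 sinh psi cosh psi and alpha cosh psi = beta cosh phi it
    yields phi' = alpha sinh psi, from which both helicoid equations follow. *)
Lemma helicoid_profile_of_catenoid (alpha beta : R) (a b : Rbar) (psi : R -> R) :
  0 < alpha -> 0 < beta -> beta ^ 2 = 1 + alpha ^ 2 ->
  catenoid_profile alpha a b psi ->
  helicoid_profile beta a b (fun u => arcsinh (Derive psi u / beta)) /\
  forall u, in_interval a b u ->
    Derive (fun u => arcsinh (Derive psi u / beta)) u = alpha * sinh (psi u).
Proof.
  intros A B AB P; set (phi := fun u => arcsinh (Derive psi u / beta)).
  assert (S : forall u, beta * sinh (phi u) = Derive psi u)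
    by (intros u; unfold phi; rewrite sinh_arcsinh; field; lra).
  (* Both sides are positive and their squares agree: beta^2 cosh^2 phi = beta^2 + psi'^2 = beta^2 -
     1 + alpha^2 sinh^2 psi = alpha^2 cosh^2 psi. *)
  assert (C : forall u, in_interval a b u -> beta * cosh (phi u) = alpha * cosh (psi u)).
  { intros u Hu.
    assert (E := cp_first _ _ _ _ P u Hu).
    assert (Ep := cosh_sqr (psi u)); assert (Eh := cosh_sqr (phi u)).
    apply Rsqr_inj; try (apply Rlt_le, Rmult_lt_0_compat; trivial; apply cosh_pos).
    rewrite !Rsqr_pow2, !Rpow_mult_distr, Ep, Eh, !Rmult_plus_distr_l.
    rewrite <- (Rpow_mult_distr beta (sinh _)), S; lra. }
  assert (D : forall u, in_interval a b u -> is_derive phi u (alpha * sinh (psi u))).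
  { intros u Hu.
    replace (alpha * sinh (psi u)) with
      ((alpha ^ 2 * sinh (psi u) * cosh (psi u)) / beta / cosh (phi u)).
    - apply is_derive_arcsinh_comp.
      apply is_derive_Rdiv_const, (cp_second _ _ _ _ P u Hu).
    - assert (K := cosh_pos (phi u)).
      transitivity (alpha * sinh (psi u) * (alpha * cosh (psi u)) / (beta * cosh (phi u)));
        [ field; lra | rewrite <- C by trivial; field; lra ]. }
  assert (D' : forall u, in_interval a b u -> Derive phi u = alpha * sinh (psi u))
    by (intros; now apply is_derive_unique, D).
  split; [ split | trivial ].
  - apply P.
  - intros u Hu; eexists; apply D, Hu.
  - intros u Hu; rewrite D', <- Rpow_mult_distr, S by trivial.
    rewrite Rpow_mult_distr; symmetry; now apply (cp_first _ _ _ _ P).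
  - intros u Hu.
    apply (is_derive_ext_loc (fun u => alpha * sinh (psi u))).
    + apply (filter_imp (in_interval a b)); [ intros; symmetry; now apply D' | ].
      apply locally_in_interval, Hu.
    + replace (beta ^ 2 * sinh (phi u) * cosh (phi u))
        with (alpha * (Derive psi u * cosh (psi u))).
      * apply is_derive_scal, is_derive_sinh_comp, Derive_correct.
        apply (cp_derivable _ _ _ _ P u Hu).
      * transitivity (beta * sinh (phi u) * (beta * cosh (phi u))); [ | ring ].
        rewrite S, C by trivial; ring.
  - unfold phi; rewrite (cp_initial _ _ _ _ P).
    unfold Rdiv; rewrite Rmult_0_l; apply arcsinh_0.
  - intros u Hu; rewrite D' by trivial; apply Rmult_lt_0_compat; trivial.
    apply sinh_pos, (cp_positive _ _ _ _ P u Hu).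
Qed.

(** The mirror construction solves phi' = alpha sinh psi for psi. Positivity of phi' becomes
    positivity of psi, and phi(0) = 0 becomes psi'(0) = 0. *)
Lemma catenoid_profile_of_helicoid (alpha beta : R) (a b : Rbar) (phi : R -> R) :
  0 < alpha -> 0 < beta -> beta ^ 2 = 1 + alpha ^ 2 ->
  helicoid_profile beta a b phi ->
  catenoid_profile alpha a b (fun u => arcsinh (Derive phi u / alpha)).
Proof.
  intros A B AB P; set (psi := fun u => arcsinh (Derive phi u / alpha)).
  assert (S : forall u, alpha * sinh (psi u) = Derive phi u)
    by (intros u; unfold psi; rewrite sinh_arcsinh; field; lra).
  assert (C : forall u, in_interval a b u -> alpha * cosh (psi u) = beta * cosh (phi u)).
  { intros u Hu.
    assert (E := hp_first _ _ _ _ P u Hu).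
    assert (Ep := cosh_sqr (psi u)); assert (Eh := cosh_sqr (phi u)).
    apply Rsqr_inj; try (apply Rlt_le, Rmult_lt_0_compat; trivial; apply cosh_pos).
    rewrite !Rsqr_pow2, !Rpow_mult_distr, Ep, Eh, !Rmult_plus_distr_l.
    rewrite <- (Rpow_mult_distr alpha (sinh _)), S; lra. }
  assert (D : forall u, in_interval a b u -> is_derive psi u (beta * sinh (phi u))).
  { intros u Hu.
    replace (beta * sinh (phi u)) with
      ((beta ^ 2 * sinh (phi u) * cosh (phi u)) / alpha / cosh (psi u)).
    - apply is_derive_arcsinh_comp.
      apply is_derive_Rdiv_const, (hp_second _ _ _ _ P u Hu).
    - assert (K := cosh_pos (psi u)).
      transitivity (beta * sinh (phi u) * (beta * cosh (phi u)) / (alpha * cosh (psi u)));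
        [ field; lra | rewrite <- C by trivial; field; lra ]. }
  assert (D' : forall u, in_interval a b u -> Derive psi u = beta * sinh (phi u))
    by (intros; now apply is_derive_unique, D).
  split.
  - apply P.
  - intros u Hu; eexists; apply D, Hu.
  - intros u Hu; rewrite D', Rpow_mult_distr, <- (Rpow_mult_distr alpha), S by trivial.
    symmetry; now apply (hp_first _ _ _ _ P).
  - intros u Hu.
    apply (is_derive_ext_loc (fun u => beta * sinh (phi u))).
    + apply (filter_imp (in_interval a b)); [ intros; symmetry; now apply D' | ].
      apply locally_in_interval, Hu.
    + replace (alpha ^ 2 * sinh (psi u) * cosh (psi u))
        with (beta * (Derive phi u * cosh (phi u))).
      * apply is_derive_scal, is_derive_sinh_comp, Derive_correct.
        apply (hp_derivable _ _ _ _ P u Hu).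
      * transitivity (alpha * sinh (psi u) * (alpha * cosh (psi u))); [ | ring ].
        rewrite S, C by trivial; ring.
  - rewrite D' by apply P; rewrite (hp_initial _ _ _ _ P), sinh_0; ring.
  - intros u Hu; unfold psi; rewrite <- arcsinh_0; apply arcsinh_lt.
    apply Rdiv_lt_0_compat; trivial; apply (hp_increasing _ _ _ _ P u Hu).
Qed.

Lemma maximal_profiles_dual (alpha beta : R) (a b c d : Rbar) (psi phi : R -> R) :
  0 < alpha -> 0 < beta -> beta ^ 2 = 1 + alpha ^ 2 ->
  maximal_solution (catenoid_profile alpha) a b psi ->
  maximal_solution (helicoid_profile beta) c d phi ->
  a = c /\ b = d /\
  forall u, in_interval a b u ->
    Derive phi u = alpha * sinh (psi u) /\ Derive psi u = beta * sinh (phi u).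
Proof.
  intros A B AB [P MP] [Q MQ].
  destruct (helicoid_profile_of_catenoid alpha beta a b psi A B AB P) as [Q' D'].
  set (phi' := fun u => arcsinh (Derive psi u / beta)) in Q', D'.
  assert (P' := catenoid_profile_of_helicoid alpha beta c d phi A B AB Q).
  (* The glued solution extends phi, so maximality confines it to (c, d); hence (a, b) is contained
     in (c, d), and phi' agrees with phi on (a, b). *)
  destruct (helicoid_profile_glue beta c d a b phi phi' Q Q')
    as (p & q & f & F & L1 & L2 & L3 & L4 & E).
  destruct (MQ p q f F L1 L2 E) as [-> ->].
  assert (I : forall u, in_interval a b u -> in_interval c d u).
  { intros u [H1 H2]; split.
    - apply Rbar_le_lt_trans with a; trivial.
    - apply Rbar_lt_le_trans with b; trivial. }
  assert (Eq : forall u, in_interval a b u -> phi u = phi' u)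
    by (intros; apply (helicoid_profile_unique beta c d a b phi phi'); auto).
  assert (D : forall u, in_interval a b u -> Derive phi u = alpha * sinh (psi u)).
  { intros u Hu; rewrite <- D' by trivial; apply Derive_ext_loc.
    apply (filter_imp (in_interval a b)); [ trivial | ].
    apply locally_in_interval, Hu. }
  (* The catenoid profile built from phi lives on the larger interval (c, d) and restricts to psi,
     because the derivative of phi is alpha sinh psi on (a, b). Maximality of psi gives equality. *)
  destruct (MP c d _ P' L3 L4) as [-> ->].
  { intros u Hu; rewrite D by trivial.
    rewrite <- (arcsinh_sinh (psi u)) at 2; f_equal; field; lra. }
  split; [ | split ]; trivial; intros u Hu; split; [ now apply D | ].
  rewrite Eq by trivial; unfold phi'; rewrite sinh_arcsinh; field; lra.
Qed.

(** * The data of the catenoid and of the helicoid *)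

(* nsatz does not read powers with exponents in nat. *)
Ltac ideal := cbn [pow] in *; solve [ nsatz ].

Definition is_derive3 (f : R -> L3) (t : R) (d : L3) : Prop :=
  is_derive (fun s => c0 (f s)) t (c0 d) /\
  is_derive (fun s => c1 (f s)) t (c1 d) /\
  is_derive (fun s => c2 (f s)) t (c2 d).

Definition is_velocity (f : R -> L3R) (t : R) (V : L3R) : Prop :=
  is_derive3 (fun s => fst (f s)) t (fst V) /\ is_derive (fun s => snd (f s)) t (snd V).

Lemma is_velocity_unique (f : R -> L3R) (t : R) (V : L3R) :
  is_velocity f t V -> velocity f t = V.
Proof.
  destruct V as [[d0 d1 d2] d3]; intros [(H0 & H1 & H2) H3]; simpl in *.
  unfold velocity; repeat f_equal; apply is_derive_unique; assumption.
Qed.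

Lemma is_derive3_scale3 (k : R -> R) (f : R -> L3) (t dk : R) (d : L3) :
  is_derive k t dk -> is_derive3 f t d ->
  is_derive3 (fun s => scale3 (k s) (f s)) t (add3 (scale3 dk (f t)) (scale3 (k t) d)).
Proof.
  intros Hk (H0 & H1 & H2).
  refine (conj _ (conj _ _)); simpl;
    [ apply (is_derive_Rmult k (fun s => c0 (f s)))
    | apply (is_derive_Rmult k (fun s => c1 (f s)))
    | apply (is_derive_Rmult k (fun s => c2 (f s))) ]; trivial.
Qed.

Lemma is_velocity_scale (k : R -> R) (f : R -> L3R) (t dk : R) (V : L3R) :
  is_derive k t dk -> is_velocity f t V ->
  is_velocity (fun s => scale (k s) (f s)) t (add (scale dk (f t)) (scale (k t) V)).
Proof.
  intros Hk [H H3]; split.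
  - apply is_derive3_scale3; trivial.
  - simpl; apply (is_derive_Rmult k (fun s => snd (f s))); trivial.
Qed.

Lemma is_derive_Rmult_const_r (f : R -> R) (x df k : R) :
  is_derive f x df -> is_derive (fun s => f s * k) x (df * k).
Proof.
  intros H; replace (df * k) with (df * k + f x * 0) by ring.
  apply (is_derive_Rmult f (fun _ => k)); trivial.
  apply is_derive_Reals, derivable_pt_lim_const.
Qed.

Lemma is_derive_Rconst (k x : R) : is_derive (fun _ : R => k) x 0.
Proof. apply is_derive_Reals, derivable_pt_lim_const. Qed.

Lemma is_derive_Rid (x : R) : is_derive (fun s : R => s) x 1.
Proof. apply is_derive_Reals, derivable_pt_lim_id. Qed.

Lemma L3R_ext (V W : L3R) :
  c0 (fst V) = c0 (fst W) -> c1 (fst V) = c1 (fst W) -> c2 (fst V) = c2 (fst W) ->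
  snd V = snd W -> V = W.
Proof. destruct V as [[]], W as [[]]; simpl; intros; subst; trivial. Qed.

Lemma sin_cos_sqr (t : R) : cos t ^ 2 + sin t ^ 2 = 1.
Proof. rewrite <- !Rsqr_pow2, Rplus_comm; apply sin2_cos2. Qed.

Lemma form_differential (x : R -> R -> L3R) (u v : R) (X Y : R * R) :
  form (differential x u v X) (differential x u v Y) =
  fst X * fst Y * form (d_u x u v) (d_u x u v)
  + (fst X * snd Y + snd X * fst Y) * form (d_u x u v) (d_v x u v)
  + snd X * snd Y * form (d_v x u v) (d_v x u v).
Proof. unfold differential, form, lorentz; simpl; ring. Qed.

(** The coordinate curves are lines of curvature: S is diagonal with opposite eigenvalues. T is the
    vector d/du divided by the conformal factor. *)
Definition catenoid_data (alpha : R) (psi : R -> R) : surface_data :=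
  mkData
    (fun u v X Y => (alpha * sinh (psi u)) ^ 2 * (fst X * fst Y + snd X * snd Y))
    (fun u v X => let k := alpha * cosh (psi u) * (/ (alpha * sinh (psi u))) ^ 2 in
                  (- (k * fst X), k * snd X))
    (fun u v => ((/ (alpha * sinh (psi u))) ^ 2, 0))
    (fun u v => Derive psi u * / (alpha * sinh (psi u))).

(** The rotation J turns the diagonal S of the catenoid into an antidiagonal one, so the coordinate
    curves become asymptotic lines, and it turns T into the direction d/dv. *)
Definition helicoid_data (beta : R) (phi : R -> R) : surface_data :=
  mkData
    (fun u v X Y => Derive phi u ^ 2 * (fst X * fst Y + snd X * snd Y))
    (fun u v X => let k := beta * cosh (phi u) * (/ Derive phi u) ^ 2 in
                  (- (k * snd X), - (k * fst X)))
    (fun u v => (0, (/ Derive phi u) ^ 2))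
    (fun u v => beta * sinh (phi u) * / Derive phi u).

Lemma catenoid_d_u (alpha : R) (a b : Rbar) (psi : R -> R) (u v : R) :
  catenoid_profile alpha a b psi -> in_interval a b u ->
  d_u (catenoid alpha psi) u v =
  (mkL3 (Derive psi u * sinh (psi u))
        (Derive psi u * cosh (psi u) * cos (alpha * v))
        (Derive psi u * cosh (psi u) * sin (alpha * v)), 1).
Proof.
  intros P Hu; assert (D := Derive_correct _ _ (cp_derivable _ _ _ _ P u Hu)).
  apply is_velocity_unique; refine (conj (conj _ (conj _ _)) _); simpl.
  - now apply is_derive_cosh_comp.
  - now apply is_derive_Rmult_const_r, is_derive_sinh_comp.
  - now apply is_derive_Rmult_const_r, is_derive_sinh_comp.
  - apply is_derive_Rid.
Qed.

Lemma catenoid_d_v (alpha : R) (psi : R -> R) (u v : R) :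
  d_v (catenoid alpha psi) u v =
  (mkL3 0 (- (alpha * sinh (psi u) * sin (alpha * v)))
          (alpha * sinh (psi u) * cos (alpha * v)), 0).
Proof.
  apply is_velocity_unique; refine (conj (conj _ (conj _ _)) _); simpl; try apply is_derive_Rconst;
    auto_derive; trivial; ring.
Qed.

Lemma catenoid_normal_d_u (alpha : R) (a b : Rbar) (psi : R -> R) (u v : R) :
  alpha <> 0 -> catenoid_profile alpha a b psi -> in_interval a b u ->
  d_u (catenoid_normal alpha psi) u v =
  let r := / (alpha * sinh (psi u)) in
  let p := Derive psi u in
  add (scale (- (alpha * p * cosh (psi u) * r ^ 2))
         (mkL3 (- sinh (psi u)) (- (cosh (psi u) * cos (alpha * v)))
               (- (cosh (psi u) * sin (alpha * v))), p))
      (scale r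
         (mkL3 (- (p * cosh (psi u))) (- (p * sinh (psi u) * cos (alpha * v)))
               (- (p * sinh (psi u) * sin (alpha * v))),
          alpha ^ 2 * sinh (psi u) * cosh (psi u))).
Proof.
  intros A P Hu; assert (D := Derive_correct _ _ (cp_derivable _ _ _ _ P u Hu)).
  assert (S : alpha * sinh (psi u) <> 0).
  { apply Rmult_integral_contrapositive_currified; trivial.
    apply Rgt_not_eq, sinh_pos, (cp_positive _ _ _ _ P u Hu). }
  apply is_velocity_unique.
  apply (is_velocity_scale (fun s => / (alpha * sinh (psi s)))
    (fun s => (mkL3 (- sinh (psi s)) (- (cosh (psi s) * cos (alpha * v)))
                 (- (cosh (psi s) * sin (alpha * v))), Derive psi s))).
  - replace (- (alpha * Derive psi u * cosh (psi u) * (/ (alpha * sinh (psi u))) ^ 2))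
      with (- (alpha * (Derive psi u * cosh (psi u))) / (alpha * sinh (psi u)) ^ 2)
      by (unfold Rdiv; rewrite pow_inv; ring).
    apply (is_derive_inv (fun s => alpha * sinh (psi s))); trivial.
    now apply is_derive_scal, is_derive_sinh_comp.
  - refine (conj (conj _ (conj _ _)) _); simpl.
    + apply (is_derive_opp (fun s => sinh (psi s))); now apply is_derive_sinh_comp.
    + apply (is_derive_opp (fun s => cosh (psi s) * cos (alpha * v))).
      now apply is_derive_Rmult_const_r, is_derive_cosh_comp.
    + apply (is_derive_opp (fun s => cosh (psi s) * sin (alpha * v))).
      now apply is_derive_Rmult_const_r, is_derive_cosh_comp.
    + apply (cp_second _ _ _ _ P u Hu).
Qed.

Lemma catenoid_normal_d_v (alpha : R) (psi : R -> R) (u v : R) :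
  d_v (catenoid_normal alpha psi) u v =
  scale (/ (alpha * sinh (psi u)))
    (mkL3 0 (alpha * cosh (psi u) * sin (alpha * v))
            (- (alpha * cosh (psi u) * cos (alpha * v))), 0).
Proof.
  apply is_velocity_unique; refine (conj (conj _ (conj _ _)) _); simpl;
    auto_derive; trivial; ring.
Qed.

(** Once the derivatives are known, the geometric identities are polynomial modulo cosh^2 = 1 +
    sinh^2, cos^2 + sin^2 = 1, the first integral and r alpha sinh psi = 1, where r stands for the
    inverse. The conformal factor is psi'^2 + 1 = (alpha sinh psi)^2. *)
Lemma catenoid_minimal (alpha : R) (a b : Rbar) (psi : R -> R) :
  alpha <> 0 -> catenoid_profile alpha a b psi ->
  conformal_minimal_immersion (strip a b) (catenoid alpha psi)
    (catenoid_normal alpha psi) (catenoid_data alpha psi).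
Proof.
  intros A P.
  assert (Do := open2_strip a b).
  assert (S0 : forall u v, strip a b u v -> alpha * sinh (psi u) <> 0).
  { intros u v Hu; apply Rmult_integral_contrapositive_currified; trivial.
    apply Rgt_not_eq, sinh_pos, (cp_positive _ _ _ _ P u Hu). }
  destruct (smooth_on_profile alpha a b psi) as (Ss & Sc & Sd);
    [ apply P | apply P | ].
  destruct (smooth_on_trig _ Do alpha) as [Tc Ts].
  assert (Sr : smooth_on (strip a b) (fun u _ => / (alpha * sinh (psi u)))).
  { apply (smooth_on_inv _ Do (fun u _ => alpha * sinh (psi u))); trivial.
    apply (smooth_on_mult _ Do (fun _ _ => alpha)); trivial.
    now apply smooth_on_const. }
  assert (Dx := fun u v (Hu : strip a b u v) =>
    conj (catenoid_d_u alpha a b psi u v P Hu)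
      (conj (catenoid_normal_d_u alpha a b psi u v A P Hu)
        (conj (S0 u v Hu) (cp_first _ _ _ _ P u Hu)))).
  split; [ split | split | split | ].
  - refine (conj _ (conj _ (conj _ _))); simpl; trivial.
    + now apply (smooth_on_mult _ Do (fun u _ => sinh (psi u))).
    + now apply (smooth_on_mult _ Do (fun u _ => sinh (psi u))).
    + now apply smooth_on_fst.
  - intros u v Hu; split; [ | apply cosh_pos ].
    unfold lorentz; simpl.
    generalize (cosh_sqr (psi u)) (sin_cos_sqr (alpha * v)); intros; ideal.
  - intros u v Hu; destruct (Dx u v Hu) as (E1 & E2 & S & F).
    rewrite E1, catenoid_d_v; unfold form, lorentz; simpl.
    generalize (cosh_sqr (psi u)) (sin_cos_sqr (alpha * v)); intros; clear E1 E2 S; ideal.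
  - intros u v Hu; destruct (Dx u v Hu) as (E1 & E2 & S & F).
    rewrite E1, catenoid_d_v; unfold form, lorentz; simpl; ring.
  - intros u v Hu; destruct (Dx u v Hu) as (E1 & E2 & S & F).
    rewrite E1; replace (form _ _) with ((alpha * sinh (psi u)) ^ 2).
    + now apply pow2_gt_0.
    + unfold form, lorentz; simpl.
      generalize (cosh_sqr (psi u)) (sin_cos_sqr (alpha * v)); intros; clear E1 E2 S; ideal.
  - refine (conj _ (conj _ (conj _ _))); simpl.
    + apply (smooth_on_mult _ Do (fun u _ => / (alpha * sinh (psi u)))); trivial.
      now apply (smooth_on_opp _ Do (fun u _ => sinh (psi u))).
    + apply (smooth_on_mult _ Do (fun u _ => / (alpha * sinh (psi u)))); trivial.
      apply (smooth_on_opp _ Do (fun u v => cosh (psi u) * cos (alpha * v))).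
      now apply (smooth_on_mult _ Do (fun u _ => cosh (psi u))).
    + apply (smooth_on_mult _ Do (fun u _ => / (alpha * sinh (psi u)))); trivial.
      apply (smooth_on_opp _ Do (fun u v => cosh (psi u) * sin (alpha * v))).
      now apply (smooth_on_mult _ Do (fun u _ => cosh (psi u))).
    + now apply (smooth_on_mult _ Do (fun u _ => / (alpha * sinh (psi u)))).
  - intros u v Hu; unfold tangent, lorentz; simpl.
    generalize (sin_cos_sqr (alpha * v)); intros; ideal.
  - intros u v X Hu; destruct (Dx u v Hu) as (E1 & E2 & S & F).
    unfold differential; rewrite E1, catenoid_d_v; unfold form, lorentz; simpl.
    generalize (cosh_sqr (psi u)) (sin_cos_sqr (alpha * v)); intros; clear E1 E2 S.
    set (r := / _); clearbody r; ideal.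
  - intros u v Hu; destruct (Dx u v Hu) as (E1 & E2 & S & F).
    assert (R1 := Rinv_l _ S).
    unfold form, lorentz; simpl.
    generalize (cosh_sqr (psi u)) (sin_cos_sqr (alpha * v)); intros; clear E1 E2 S.
    set (r := / _) in *; clearbody r; ideal.
  - intros u v Hu; destruct (Dx u v Hu) as (E1 & E2 & S & F).
    assert (R1 := Rinv_l _ S).
    rewrite E1, catenoid_d_v.
    replace (det_tangent _ _ _ _) with ((alpha * sinh (psi u)) ^ 2).
    + now apply pow2_gt_0.
    + unfold det_tangent, det3; simpl.
      generalize (cosh_sqr (psi u)) (sin_cos_sqr (alpha * v)); intros; clear E1 E2 S.
      set (r := / _) in *; clearbody r; ideal.
  - intros u v X Y Hu; destruct (Dx u v Hu) as (E1 & E2 & S & F).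
    rewrite form_differential, E1, catenoid_d_v; unfold form, lorentz; simpl.
    generalize (cosh_sqr (psi u)) (sin_cos_sqr (alpha * v)); intros; clear E1 E2 S; ideal.
  - intros u v [X Y] Hu; destruct (Dx u v Hu) as (E1 & E2 & S & F).
    assert (R1 := Rinv_l _ S).
    unfold differential, nabla, differential; rewrite E1, E2, catenoid_d_v, catenoid_normal_d_v.
    generalize (cosh_sqr (psi u)) (sin_cos_sqr (alpha * v)); intros; clear E1 E2 S.
    apply L3R_ext; simpl; unfold lorentz; simpl;
    set (r := / _) in *; clearbody r; ideal.
  - intros u v Hu; unfold form, lorentz; simpl; ring.
  - intros u v Hu; destruct (Dx u v Hu) as (E1 & E2 & S & F).
    assert (R1 := Rinv_l _ S).
    unfold differential; rewrite E1, catenoid_d_v.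
    generalize (cosh_sqr (psi u)) (sin_cos_sqr (alpha * v)); intros; clear E1 E2 S.
    apply L3R_ext; simpl;
    set (r := / _) in *; clearbody r; ideal.
  - intros u v Hu; unfold trace; simpl; ring.
Qed.

Lemma helicoid_d_u (beta : R) (a b : Rbar) (phi : R -> R) (u v : R) :
  helicoid_profile beta a b phi -> in_interval a b u ->
  d_u (helicoid beta phi) u v =
  (mkL3 (Derive phi u * sinh (phi u))
        (Derive phi u * cosh (phi u) * cos (beta * v))
        (Derive phi u * cosh (phi u) * sin (beta * v)), 0).
Proof.
  intros P Hu; assert (D := Derive_correct _ _ (hp_derivable _ _ _ _ P u Hu)).
  apply is_velocity_unique; refine (conj (conj _ (conj _ _)) _); simpl.
  - now apply is_derive_cosh_comp.
  - now apply is_derive_Rmult_const_r, is_derive_sinh_comp.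
  - now apply is_derive_Rmult_const_r, is_derive_sinh_comp.
  - apply is_derive_Rconst.
Qed.

Lemma helicoid_d_v (beta : R) (phi : R -> R) (u v : R) :
  d_v (helicoid beta phi) u v =
  (mkL3 0 (- (beta * sinh (phi u) * sin (beta * v)))
          (beta * sinh (phi u) * cos (beta * v)), 1).
Proof.
  apply is_velocity_unique; refine (conj (conj _ (conj _ _)) _); simpl;
    auto_derive; trivial; ring.
Qed.

Lemma helicoid_normal_d_u (beta : R) (a b : Rbar) (phi : R -> R) (u v : R) :
  helicoid_profile beta a b phi -> in_interval a b u ->
  d_u (helicoid_normal beta phi) u v =
  let r := / Derive phi u in
  add (scale (- (beta ^ 2 * sinh (phi u) * cosh (phi u) * r ^ 2))
         (mkL3 0 (sin (beta * v)) (- cos (beta * v)), beta * sinh (phi u)))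
      (scale r (mkL3 0 0 0, beta * (Derive phi u * cosh (phi u)))).
Proof.
  intros P Hu; assert (D := Derive_correct _ _ (hp_derivable _ _ _ _ P u Hu)).
  assert (L := hp_increasing _ _ _ _ P u Hu).
  apply is_velocity_unique.
  apply (is_velocity_scale (fun s => / Derive phi s)
    (fun s => (mkL3 0 (sin (beta * v)) (- cos (beta * v)), beta * sinh (phi s)))).
  - replace (- (beta ^ 2 * sinh (phi u) * cosh (phi u) * (/ Derive phi u) ^ 2))
      with (- (beta ^ 2 * sinh (phi u) * cosh (phi u)) / (Derive phi u) ^ 2)
      by (field; lra).
    apply (is_derive_inv (Derive phi)); [ apply (hp_second _ _ _ _ P u Hu) | lra ].
  - refine (conj (conj _ (conj _ _)) _); simpl; try apply is_derive_Rconst.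
    now apply is_derive_scal, is_derive_sinh_comp.
Qed.

Lemma helicoid_normal_d_v (beta : R) (phi : R -> R) (u v : R) :
  d_v (helicoid_normal beta phi) u v =
  scale (/ Derive phi u) (mkL3 0 (beta * cos (beta * v)) (beta * sin (beta * v)), 0).
Proof.
  apply is_velocity_unique; refine (conj (conj _ (conj _ _)) _); simpl;
    auto_derive; trivial; ring.
Qed.

(** The same reduction to polynomial identities, with r standing for 1 / phi' and conformal factor
    phi'^2 = 1 + beta^2 sinh^2 phi. *)
Lemma helicoid_minimal (beta : R) (a b : Rbar) (phi : R -> R) :
  helicoid_profile beta a b phi ->
  conformal_minimal_immersion (strip a b) (helicoid beta phi)
    (helicoid_normal beta phi) (helicoid_data beta phi).
Proof.
  intros P.
  assert (Do := open2_strip a b).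
  assert (S0 : forall u v, strip a b u v -> Derive phi u <> 0)
    by (intros u v Hu; apply Rgt_not_eq, (hp_increasing _ _ _ _ P u Hu)).
  destruct (smooth_on_profile beta a b phi) as (Ss & Sc & Sd);
    [ apply P | apply P | ].
  destruct (smooth_on_trig _ Do beta) as [Tc Ts].
  assert (Sr : smooth_on (strip a b) (fun u _ => / Derive phi u))
    by now apply (smooth_on_inv _ Do (fun u _ => Derive phi u)).
  assert (Dx := fun u v (Hu : strip a b u v) =>
    conj (helicoid_d_u beta a b phi u v P Hu)
      (conj (helicoid_normal_d_u beta a b phi u v P Hu)
        (conj (S0 u v Hu) (hp_first _ _ _ _ P u Hu)))).
  split; [ split | split | split | ].
  - refine (conj _ (conj _ (conj _ _))); simpl; trivial.
    + now apply (smooth_on_mult _ Do (fun u _ => sinh (phi u))).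
    + now apply (smooth_on_mult _ Do (fun u _ => sinh (phi u))).
    + now apply smooth_on_snd.
  - intros u v Hu; split; [ | apply cosh_pos ].
    unfold lorentz; simpl.
    generalize (cosh_sqr (phi u)) (sin_cos_sqr (beta * v)); intros; ideal.
  - intros u v Hu; destruct (Dx u v Hu) as (E1 & E2 & S & F).
    rewrite E1, helicoid_d_v; unfold form, lorentz; simpl.
    generalize (cosh_sqr (phi u)) (sin_cos_sqr (beta * v)); intros; clear E1 E2 S; ideal.
  - intros u v Hu; destruct (Dx u v Hu) as (E1 & E2 & S & F).
    rewrite E1, helicoid_d_v; unfold form, lorentz; simpl; ring.
  - intros u v Hu; destruct (Dx u v Hu) as (E1 & E2 & S & F).
    rewrite E1; replace (form _ _) with (Derive phi u ^ 2).
    + now apply pow2_gt_0.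
    + unfold form, lorentz; simpl.
      generalize (cosh_sqr (phi u)) (sin_cos_sqr (beta * v)); intros; clear E1 E2 S; ideal.
  - refine (conj _ (conj _ (conj _ _))); simpl.
    + apply (smooth_on_mult _ Do (fun u _ => / Derive phi u)); trivial.
      now apply smooth_on_const.
    + now apply (smooth_on_mult _ Do (fun u _ => / Derive phi u)).
    + apply (smooth_on_mult _ Do (fun u _ => / Derive phi u)); trivial.
      now apply (smooth_on_opp _ Do (fun u v => cos (beta * v))).
    + apply (smooth_on_mult _ Do (fun u _ => / Derive phi u)); trivial.
      apply (smooth_on_mult _ Do (fun _ _ => beta)); trivial.
      now apply smooth_on_const.
  - intros u v Hu; unfold tangent, lorentz; simpl; ring.
  - intros u v X Hu; destruct (Dx u v Hu) as (E1 & E2 & S & F).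
    unfold differential; rewrite E1, helicoid_d_v; unfold form, lorentz; simpl.
    generalize (cosh_sqr (phi u)) (sin_cos_sqr (beta * v)); intros; clear E1 E2 S.
    set (r := / _); clearbody r; ideal.
  - intros u v Hu; destruct (Dx u v Hu) as (E1 & E2 & S & F).
    assert (R1 := Rinv_l _ S).
    unfold form, lorentz; simpl.
    generalize (cosh_sqr (phi u)) (sin_cos_sqr (beta * v)); intros; clear E1 E2 S.
    set (r := / _) in *; clearbody r; ideal.
  - intros u v Hu; destruct (Dx u v Hu) as (E1 & E2 & S & F).
    assert (R1 := Rinv_l _ S).
    rewrite E1, helicoid_d_v.
    replace (det_tangent _ _ _ _) with (Derive phi u ^ 2).
    + now apply pow2_gt_0.
    + unfold det_tangent, det3; simpl.
      generalize (cosh_sqr (phi u)) (sin_cos_sqr (beta * v)); intros; clear E1 E2 S.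
      set (r := / _) in *; clearbody r; ideal.
  - intros u v X Y Hu; destruct (Dx u v Hu) as (E1 & E2 & S & F).
    rewrite form_differential, E1, helicoid_d_v; unfold form, lorentz; simpl.
    generalize (cosh_sqr (phi u)) (sin_cos_sqr (beta * v)); intros; clear E1 E2 S; ideal.
  - intros u v [X Y] Hu; destruct (Dx u v Hu) as (E1 & E2 & S & F).
    assert (R1 := Rinv_l _ S).
    unfold differential, nabla, differential; rewrite E1, E2, helicoid_d_v, helicoid_normal_d_v.
    generalize (cosh_sqr (phi u)) (sin_cos_sqr (beta * v)); intros; clear E1 E2 S.
    apply L3R_ext; simpl; unfold lorentz; simpl;
    set (r := / _) in *; clearbody r; ideal.
  - intros u v Hu; unfold form, lorentz; simpl; ring.
  - intros u v Hu; destruct (Dx u v Hu) as (E1 & E2 & S & F).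
    assert (R1 := Rinv_l _ S).
    unfold differential; rewrite E1, helicoid_d_v.
    generalize (cosh_sqr (phi u)) (sin_cos_sqr (beta * v)); intros; clear E1 E2 S.
    apply L3R_ext; simpl;
    set (r := / _) in *; clearbody r; ideal.
  - intros u v Hu; unfold trace; simpl; ring.
Qed.

(** * Moving frames in L^3 *)

Lemma L3_ext (p q : L3) : c0 p = c0 q -> c1 p = c1 q -> c2 p = c2 q -> p = q.
Proof. destruct p, q; simpl; intros; subst; trivial. Qed.

Lemma lorentz_sym (p q : L3) : lorentz p q = lorentz q p.
Proof. unfold lorentz; ring. Qed.

Lemma lorentz_add3_l (p q r : L3) : lorentz (add3 p q) r = lorentz p r + lorentz q r.
Proof. unfold lorentz; simpl; ring. Qed.

Lemma lorentz_scale3_l (k : R) (p q : L3) : lorentz (scale3 k p) q = k * lorentz p q.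
Proof. unfold lorentz; simpl; ring. Qed.

Lemma lorentz_scale3_r (k : R) (p q : L3) : lorentz p (scale3 k q) = k * lorentz p q.
Proof. unfold lorentz; simpl; ring. Qed.

Record direct_frame (p e f : L3) : Prop := {
  df_pp : lorentz p p = -1;
  df_ee : lorentz e e = 1;
  df_ff : lorentz f f = 1;
  df_pe : lorentz p e = 0;
  df_pf : lorentz p f = 0;
  df_ef : lorentz e f = 0;
  df_det : det3 p e f = 1
}.

(* Gram determinants carry the sign of the form. *)
Lemma det3_mul (p q r a b c : L3) :
  det3 p q r * det3 a b c =
  - det3 (mkL3 (lorentz p a) (lorentz p b) (lorentz p c))
         (mkL3 (lorentz q a) (lorentz q b) (lorentz q c))
         (mkL3 (lorentz r a) (lorentz r b) (lorentz r c)).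
Proof. unfold det3, lorentz; simpl; ring. Qed.

(** The square of the determinant is minus the Gram determinant, here 1, so a positive determinant
    equals 1. *)
Lemma direct_frame_intro (p e f : L3) :
  lorentz p p = -1 -> lorentz e e = 1 -> lorentz f f = 1 ->
  lorentz p e = 0 -> lorentz p f = 0 -> lorentz e f = 0 ->
  0 < det3 p e f -> direct_frame p e f.
Proof.
  intros Hpp Hee Hff Hpe Hpf Hef Hd; split; trivial.
  assert (G := det3_mul p e f p e f).
  rewrite (lorentz_sym e p), (lorentz_sym f p), (lorentz_sym f e) in G.
  rewrite Hpp, Hee, Hff, Hpe, Hpf, Hef in G; unfold det3 at 3 in G; simpl in G.
  nra.
Qed.

Lemma frame_decomposition (p e f V : L3) :
  direct_frame p e f ->
  V = add3 (scale3 (- lorentz V p) p)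
        (add3 (scale3 (lorentz V e) e) (scale3 (lorentz V f) f)).
Proof.
  intros [Hpp Hee Hff Hpe Hpf Hef Hd].
  (* Cramer's rule, the minors being read off det3_mul. *)
  assert (Cr : scale3 (det3 p e f) V =
    add3 (scale3 (det3 V e f) p) (add3 (scale3 (det3 p V f) e) (scale3 (det3 p e V) f)))
    by (apply L3_ext; unfold det3; simpl; ring).
  assert (G1 := det3_mul V e f p e f).
  assert (G2 := det3_mul p V f p e f).
  assert (G3 := det3_mul p e V p e f).
  rewrite (lorentz_sym e p), (lorentz_sym f p), (lorentz_sym f e) in *.
  rewrite Hpp, Hee, Hff, Hpe, Hpf, Hef, Hd in *.
  unfold det3 at 2 in G1; unfold det3 at 2 in G2; unfold det3 at 2 in G3; simpl in *.
  replace (- lorentz V p) with (det3 V e f) by lra.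
  replace (lorentz V e) with (det3 p V f) by lra.
  replace (lorentz V f) with (det3 p e V) by lra.
  rewrite <- Cr; apply L3_ext; simpl; ring.
Qed.

(** As a function of V, the Lorentz transformation that takes a direct frame p, e, f to the standard
    basis of L^3; the minus sign compensates <p, p> = -1. It provides the isometry of the rigidity
    statement. *)
Definition frame_coordinates (p e f V : L3) : L3 :=
  mkL3 (- lorentz V p) (lorentz V e) (lorentz V f).

(** Reversed Cauchy-Schwarz inequality for future timelike vectors. It ensures that a change of
    frame keeps the first coordinate positive, so that H^2 is preserved and not exchanged with its
    opposite sheet. *)
Lemma H2_lorentz_neg (p q : L3) : H2 p -> H2 q -> lorentz p q < 0.
Proof.
  intros [Hp Hp0] [Hq Hq0]; unfold lorentz in *.
  apply Rnot_le_lt; intros L.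
  set (t := c1 p * c1 q + c2 p * c2 q).
  assert (L' : (c0 p * c0 q) ^ 2 <= t ^ 2).
  { apply pow_incr; split; [ | unfold t; lra ].
    apply Rlt_le, Rmult_lt_0_compat; trivial. }
  assert (E : (c0 p * c0 q) ^ 2 =
    (1 + c1 p ^ 2 + c2 p ^ 2) * (1 + c1 q ^ 2 + c2 q ^ 2))
    by (replace (1 + c1 p ^ 2 + c2 p ^ 2) with (c0 p ^ 2) by lra;
        replace (1 + c1 q ^ 2 + c2 q ^ 2) with (c0 q ^ 2) by lra; ring).
  (* Lagrange's identity, that is, Cauchy-Schwarz in the plane with its remainder explicit. *)
  assert (CS : t ^ 2 + (c1 p * c2 q - c2 p * c1 q) ^ 2 =
    (c1 p ^ 2 + c2 p ^ 2) * (c1 q ^ 2 + c2 q ^ 2)) by (unfold t; ring).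
  assert (H1 := pow2_ge_0 (c1 p * c2 q - c2 p * c1 q)).
  assert (H2 := pow2_ge_0 (c1 p)); assert (H3 := pow2_ge_0 (c2 p)).
  assert (H4 := pow2_ge_0 (c1 q)); assert (H5 := pow2_ge_0 (c2 q)).
  lra.
Qed.

Lemma direct_isometry_frame_coordinates (p e f : L3) :
  direct_frame p e f -> H2 p -> direct_isometry_H2 (frame_coordinates p e f).
Proof.
  intros F Hp.
  assert (L : forall V W, lorentz (frame_coordinates p e f V) (frame_coordinates p e f W)
                          = lorentz V W).
  { intros V W; rewrite (frame_decomposition p e f V F) at 2.
    rewrite !lorentz_add3_l, !lorentz_scale3_l.
    rewrite (lorentz_sym p W), (lorentz_sym e W), (lorentz_sym f W).
    unfold frame_coordinates, lorentz at 1; simpl; ring. }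
  split; trivial.
  - intros V W; apply L3_ext; unfold frame_coordinates, lorentz; simpl; ring.
  - intros k V; apply L3_ext; unfold frame_coordinates, lorentz; simpl; ring.
  - intros V HV; split; [ rewrite L; apply HV | ].
    simpl; generalize (H2_lorentz_neg V p HV Hp); lra.
  (* Since det (p, e, f) = 1, the Gram formula expresses det (U, V, W) by products with the frame;
     its minus sign is the one in the first frame coordinate. *)
  - intros U V W; assert (G := det3_mul U V W p e f).
    rewrite (df_det p e f F), Rmult_1_r in G; rewrite G.
    unfold frame_coordinates, det3; simpl; ring.
Qed.

(** * Differentiation of vector functions and constancy on strips *)

Lemma is_derive3_eq (f : R -> L3) (t : R) (d d' : L3) :
  is_derive3 f t d -> d = d' -> is_derive3 f t d'.
Proof. now intros H <-. Qed.

Lemma is_derive3_add3 (f g : R -> L3) (t : R) (df dg : L3) :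
  is_derive3 f t df -> is_derive3 g t dg ->
  is_derive3 (fun s => add3 (f s) (g s)) t (add3 df dg).
Proof.
  intros (H0 & H1 & H2) (K0 & K1 & K2); refine (conj _ (conj _ _)); simpl.
  - now apply (is_derive_plus (fun s => c0 (f s)) (fun s => c0 (g s))).
  - now apply (is_derive_plus (fun s => c1 (f s)) (fun s => c1 (g s))).
  - now apply (is_derive_plus (fun s => c2 (f s)) (fun s => c2 (g s))).
Qed.

Lemma is_derive_lorentz (f g : R -> L3) (t : R) (df dg : L3) :
  is_derive3 f t df -> is_derive3 g t dg ->
  is_derive (fun s => lorentz (f s) (g s)) t (lorentz df (g t) + lorentz (f t) dg).
Proof.
  intros (H0 & H1 & H2) (K0 & K1 & K2).
  replace (lorentz df (g t) + lorentz (f t) dg) with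
    (- (c0 df * c0 (g t) + c0 (f t) * c0 dg) + (c1 df * c1 (g t) + c1 (f t) * c1 dg)
     + (c2 df * c2 (g t) + c2 (f t) * c2 dg)) by (unfold lorentz; ring).
  apply (is_derive_plus (fun s => - (c0 (f s) * c0 (g s)) + c1 (f s) * c1 (g s))
                        (fun s => c2 (f s) * c2 (g s))).
  - apply (is_derive_plus (fun s => - (c0 (f s) * c0 (g s)))
                          (fun s => c1 (f s) * c1 (g s))).
    + apply (is_derive_opp (fun s => c0 (f s) * c0 (g s))).
      now apply (is_derive_Rmult (fun s => c0 (f s)) (fun s => c0 (g s))).
    + now apply (is_derive_Rmult (fun s => c1 (f s)) (fun s => c1 (g s))).
  - now apply (is_derive_Rmult (fun s => c2 (f s)) (fun s => c2 (g s))).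
Qed.

(** The skew-symmetry rule of moving frames: a component of one derivative is read off from the
    derivative of the other vector. *)
Lemma lorentz_constant_derive (f g : R -> L3) (t k : R) (df dg : L3) :
  locally t (fun s => lorentz (f s) (g s) = k) ->
  is_derive3 f t df -> is_derive3 g t dg ->
  lorentz df (g t) = - lorentz (f t) dg.
Proof.
  intros Hk Hf Hg; assert (D := is_derive_lorentz f g t df dg Hf Hg).
  assert (Z : is_derive (fun s => lorentz (f s) (g s)) t 0).
  { apply (is_derive_ext_loc (fun _ => k)); [ | apply is_derive_Rconst ].
    revert Hk; apply filter_imp; intros; symmetry; trivial. }
  assert (E := is_derive_unique _ _ _ D); rewrite (is_derive_unique _ _ _ Z) in E; lra.
Qed.

Lemma smooth_on_is_derive (D : R -> R -> Prop) (f : R -> R -> R) (u v : R) :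
  smooth_on D f -> D u v ->
  is_derive (fun s => f s v) u (Derive (fun s => f s v) u) /\
  is_derive (fun s => f u s) v (Derive (fun s => f u s) v).
Proof.
  intros Hf H; destruct (Hf 1%nat u v H) as (_ & H1 & H2 & _).
  split; apply Derive_correct; trivial.
Qed.

Lemma smooth_map_on_is_velocity (D : R -> R -> Prop) (x : R -> R -> L3R) (u v : R) :
  smooth_map_on D x -> D u v ->
  is_velocity (fun s => x s v) u (d_u x u v) /\
  is_velocity (fun s => x u s) v (d_v x u v).
Proof.
  intros (H0 & H1 & H2 & H3) H.
  destruct (smooth_on_is_derive D _ u v H0 H) as [U0 V0].
  destruct (smooth_on_is_derive D _ u v H1 H) as [U1 V1].
  destruct (smooth_on_is_derive D _ u v H2 H) as [U2 V2].
  destruct (smooth_on_is_derive D _ u v H3 H) as [U3 V3].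
  split; refine (conj (conj _ (conj _ _)) _); simpl; trivial.
Qed.

(** The frame vector e is a multiple of a first derivative of x, so differentiating e requires
    second derivatives of x. *)
Lemma smooth_map_on_d_u (D : R -> R -> Prop) (x : R -> R -> L3R) :
  smooth_map_on D x -> smooth_map_on D (d_u x).
Proof.
  assert (K : forall f, smooth_on D f ->
                smooth_on D (fun u v => Derive (fun s => f s v) u)).
  { intros f Hf n u v H; now apply (Hf (S n) u v H). }
  intros (H0 & H1 & H2 & H3).
  refine (conj (K _ H0) (conj (K _ H1) (conj (K _ H2) (K _ H3)))).
Qed.

(** A horizontal move to u = 0 followed by a vertical one to v = 0 stays in the strip. *)
Lemma constant_on_strip (a b : Rbar) (f : R -> R -> R) :
  in_interval a b 0 ->
  (forall u v, strip a b u v -> is_derive (fun s => f s v) u 0) ->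
  (forall u v, strip a b u v -> is_derive (fun s => f u s) v 0) ->
  forall u v, strip a b u v -> f u v = f 0 0.
Proof.
  intros I Hu Hv u v H; transitivity (f 0 v).
  - apply (constant_on_interval a b (fun s => f s v)); trivial.
    intros t Ht; now apply Hu.
  - apply (constant_on_interval m_infty p_infty (fun s => f 0 s)); [ | easy | easy ].
    intros t _; now apply Hv.
Qed.

Lemma constant3_on_strip (a b : Rbar) (f : R -> R -> L3) :
  in_interval a b 0 ->
  (forall u v, strip a b u v -> is_derive3 (fun s => f s v) u (mkL3 0 0 0)) ->
  (forall u v, strip a b u v -> is_derive3 (fun s => f u s) v (mkL3 0 0 0)) ->
  forall u v, strip a b u v -> f u v = f 0 0.
Proof.
  intros I Hu Hv u v H; apply L3_ext.
  - apply (constant_on_strip a b (fun u v => c0 (f u v))); trivial;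
      intros s t Hst; [ destruct (Hu s t Hst) as (H0 & H1 & H2)
                      | destruct (Hv s t Hst) as (H0 & H1 & H2) ]; trivial.
  - apply (constant_on_strip a b (fun u v => c1 (f u v))); trivial;
      intros s t Hst; [ destruct (Hu s t Hst) as (H0 & H1 & H2)
                      | destruct (Hv s t Hst) as (H0 & H1 & H2) ]; trivial.
  - apply (constant_on_strip a b (fun u v => c2 (f u v))); trivial;
      intros s t Hst; [ destruct (Hu s t Hst) as (H0 & H1 & H2)
                      | destruct (Hv s t Hst) as (H0 & H1 & H2) ]; trivial.
Qed.

(** * The frame equations of the helicoid and their solution *)

Definition comb (x y z : R) (p e f : L3) : L3 :=
  add3 (scale3 x p) (add3 (scale3 y e) (scale3 z f)).

Lemma is_derive3_comb (x y z : R -> R) (p e f : R -> L3) (t dx dy dz : R) (dp de df : L3) :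
  is_derive x t dx -> is_derive y t dy -> is_derive z t dz ->
  is_derive3 p t dp -> is_derive3 e t de -> is_derive3 f t df ->
  is_derive3 (fun s => comb (x s) (y s) (z s) (p s) (e s) (f s)) t
    (add3 (comb dx dy dz (p t) (e t) (f t)) (comb (x t) (y t) (z t) dp de df)).
Proof.
  intros Hx Hy Hz Hp He Hf; eapply is_derive3_eq.
  - apply is_derive3_add3; [ exact (is_derive3_scale3 x p t dx dp Hx Hp) | ].
    apply is_derive3_add3;
      [ exact (is_derive3_scale3 y e t dy de Hy He)
      | exact (is_derive3_scale3 z f t dz df Hz Hf) ].
  - apply L3_ext; simpl; ring.
Qed.

(* The Frenet-type equations of the frame formed by the H^2-component p of the
   helicoid, the unit vector e along p_u, and the vector f completing it. *)
Record helicoid_frame (beta : R) (phi : R -> R) (D : R -> R -> Prop)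
    (p e f : R -> R -> L3) : Prop := {
  hf_frame : forall u v, D u v -> direct_frame (p u v) (e u v) (f u v);
  hf_p_u : forall u v, D u v ->
    is_derive3 (fun s => p s v) u (scale3 (Derive phi u) (e u v));
  hf_p_v : forall u v, D u v ->
    is_derive3 (fun s => p u s) v (scale3 (beta * sinh (phi u)) (f u v));
  hf_e_u : forall u v, D u v ->
    is_derive3 (fun s => e s v) u (scale3 (Derive phi u) (p u v));
  hf_e_v : forall u v, D u v ->
    is_derive3 (fun s => e u s) v (scale3 (beta * cosh (phi u)) (f u v));
  hf_f_u : forall u v, D u v -> is_derive3 (fun s => f s v) u (mkL3 0 0 0);
  hf_f_v : forall u v, D u v ->
    is_derive3 (fun s => f u s) v
      (add3 (scale3 (beta * sinh (phi u)) (p u v))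
            (scale3 (- (beta * cosh (phi u))) (e u v)))
}.

(* The frame is the image of a constant frame under a boost of parameter phi u
   followed by a rotation of angle beta v; undoing both gives constants. *)
Lemma helicoid_frame_solution (beta : R) (a b : Rbar) (phi : R -> R)
    (p e f : R -> R -> L3) :
  helicoid_profile beta a b phi -> helicoid_frame beta phi (strip a b) p e f ->
  forall u v, strip a b u v ->
    p u v = comb (cosh (phi u)) (sinh (phi u) * cos (beta * v))
              (sinh (phi u) * sin (beta * v)) (p 0 0) (e 0 0) (f 0 0) /\
    f u v = comb 0 (- sin (beta * v)) (cos (beta * v)) (p 0 0) (e 0 0) (f 0 0).
Proof.
  intros P F.
  assert (I := hp_interval _ _ _ _ P).
  assert (D := fun u Hu => Derive_correct _ _ (hp_derivable _ _ _ _ P u Hu)).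
  (* With E = - sinh phi p + cosh phi e, the pair Q1, E undoes the boost, and Q2 = cos E - sin f, Q3
     = sin E + cos f undo the rotation of angle beta v. These three vectors turn out to be
     constant. *)
  set (Q1 := fun u v : R => comb (cosh (phi u)) (- sinh (phi u)) 0 (p u v) (e u v) (f u v)).
  set (Q2 := fun u v : R => comb (- sinh (phi u) * cos (beta * v))
    (cosh (phi u) * cos (beta * v)) (- sin (beta * v)) (p u v) (e u v) (f u v)).
  set (Q3 := fun u v : R => comb (- sinh (phi u) * sin (beta * v))
    (cosh (phi u) * sin (beta * v)) (cos (beta * v)) (p u v) (e u v) (f u v)).
  assert (DS : forall u, in_interval a b u ->
    is_derive (fun s => - sinh (phi s)) u (- (Derive phi u * cosh (phi u)))).
  { intros u Hu; apply (is_derive_opp (fun s => sinh (phi s))).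
    now apply is_derive_sinh_comp, D. }
  assert (DC : forall u, in_interval a b u ->
    is_derive (fun s => cosh (phi s)) u (Derive phi u * sinh (phi u)))
    by (intros u Hu; now apply is_derive_cosh_comp, D).
  assert (HU : forall (x y z : R -> R) (dx dy dz u v : R), strip a b u v ->
    is_derive x u dx -> is_derive y u dy -> is_derive z u dz ->
    is_derive3 (fun s => comb (x s) (y s) (z s) (p s v) (e s v) (f s v)) u
      (add3 (comb dx dy dz (p u v) (e u v) (f u v))
         (comb (x u) (y u) (z u) (scale3 (Derive phi u) (e u v))
            (scale3 (Derive phi u) (p u v)) (mkL3 0 0 0)))).
  { intros x y z dx dy dz u v H Hx Hy Hz.
    exact (is_derive3_comb x y z (fun s => p s v) (fun s => e s v) (fun s => f s v)
      u dx dy dz _ _ _ Hx Hy Hz (hf_p_u _ _ _ _ _ _ F u v H)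
      (hf_e_u _ _ _ _ _ _ F u v H) (hf_f_u _ _ _ _ _ _ F u v H)). }
  assert (HV : forall (x y z : R -> R) (dx dy dz u v : R), strip a b u v ->
    is_derive x v dx -> is_derive y v dy -> is_derive z v dz ->
    is_derive3 (fun s => comb (x s) (y s) (z s) (p u s) (e u s) (f u s)) v
      (add3 (comb dx dy dz (p u v) (e u v) (f u v))
         (comb (x v) (y v) (z v) (scale3 (beta * sinh (phi u)) (f u v))
            (scale3 (beta * cosh (phi u)) (f u v))
            (add3 (scale3 (beta * sinh (phi u)) (p u v))
                  (scale3 (- (beta * cosh (phi u))) (e u v)))))).
  { intros x y z dx dy dz u v H Hx Hy Hz.
    exact (is_derive3_comb x y z (fun s => p u s) (fun s => e u s) (fun s => f u s)
      v dx dy dz _ _ _ Hx Hy Hz (hf_p_v _ _ _ _ _ _ F u v H)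
      (hf_e_v _ _ _ _ _ _ F u v H) (hf_f_v _ _ _ _ _ _ F u v H)). }
  assert (Dcos : forall k v : R,
    is_derive (fun s => k * cos (beta * s)) v (- (k * beta * sin (beta * v))))
    by (intros; auto_derive; trivial; ring).
  assert (Dsin : forall k v : R,
    is_derive (fun s => k * sin (beta * s)) v (k * beta * cos (beta * v)))
    by (intros; auto_derive; trivial; ring).
  assert (Dcos1 : forall v : R,
    is_derive (fun s => cos (beta * s)) v (- (beta * sin (beta * v))))
    by (intros; auto_derive; trivial; ring).
  assert (Dsin1 : forall v : R,
    is_derive (fun s => - sin (beta * s)) v (- (beta * cos (beta * v))))
    by (intros; auto_derive; trivial; ring).
  assert (K1 : forall u v, strip a b u v -> Q1 u v = Q1 0 0).
  { apply constant3_on_strip; trivial; intros u v H.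
    - eapply is_derive3_eq.
      + exact (HU (fun s => cosh (phi s)) (fun s => - sinh (phi s)) (fun _ => 0) _ _ _ u v H
                 (DC u H) (DS u H) (is_derive_Rconst 0 u)).
      + apply L3_ext; simpl; ring.
    - eapply is_derive3_eq.
      + exact (HV (fun _ => cosh (phi u)) (fun _ => - sinh (phi u)) (fun _ => 0) _ _ _ u v H
                 (is_derive_Rconst _ v) (is_derive_Rconst _ v) (is_derive_Rconst 0 v)).
      + apply L3_ext; simpl; ring. }
  assert (K2 : forall u v, strip a b u v -> Q2 u v = Q2 0 0).
  { apply constant3_on_strip; trivial; intros u v H.
    - eapply is_derive3_eq.
      + exact (HU (fun s => - sinh (phi s) * cos (beta * v))
                 (fun s => cosh (phi s) * cos (beta * v)) (fun _ => - sin (beta * v))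
                 _ _ _ u v H (is_derive_Rmult_const_r _ u _ _ (DS u H))
                 (is_derive_Rmult_const_r _ u _ _ (DC u H)) (is_derive_Rconst _ u)).
      + apply L3_ext; simpl; ring.
    - eapply is_derive3_eq.
      + exact (HV (fun s => - sinh (phi u) * cos (beta * s))
                 (fun s => cosh (phi u) * cos (beta * s)) (fun s => - sin (beta * s))
                 _ _ _ u v H (Dcos _ v) (Dcos _ v) (Dsin1 v)).
      (* In the notation E = - sinh phi p + cosh phi e, the identity cosh^2 - sinh^2 = 1 gives E_v =
         beta f, while f_v = - beta E; the terms of the derivative of Q2 cancel in pairs. *)
      + assert (E := cosh_sqr (phi u)); apply L3_ext; simpl; clear - E; ideal. }
  assert (K3 : forall u v, strip a b u v -> Q3 u v = Q3 0 0).
  { apply constant3_on_strip; trivial; intros u v H.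
    - eapply is_derive3_eq.
      + exact (HU (fun s => - sinh (phi s) * sin (beta * v))
                 (fun s => cosh (phi s) * sin (beta * v)) (fun _ => cos (beta * v))
                 _ _ _ u v H (is_derive_Rmult_const_r _ u _ _ (DS u H))
                 (is_derive_Rmult_const_r _ u _ _ (DC u H)) (is_derive_Rconst _ u)).
      + apply L3_ext; simpl; ring.
    - eapply is_derive3_eq.
      + exact (HV (fun s => - sinh (phi u) * sin (beta * s))
                 (fun s => cosh (phi u) * sin (beta * s)) (fun s => cos (beta * s))
                 _ _ _ u v H (Dsin _ v) (Dsin _ v) (Dcos1 v)).
      + assert (E := cosh_sqr (phi u)); apply L3_ext; simpl; clear - E; ideal. }
  assert (Z1 : Q1 0 0 = p 0 0).
  { unfold Q1; rewrite (hp_initial _ _ _ _ P), cosh_0, sinh_0.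
    apply L3_ext; simpl; ring. }
  assert (Z2 : Q2 0 0 = e 0 0).
  { unfold Q2; rewrite (hp_initial _ _ _ _ P), cosh_0, sinh_0, Rmult_0_r, cos_0, sin_0.
    apply L3_ext; simpl; ring. }
  assert (Z3 : Q3 0 0 = f 0 0).
  { unfold Q3; rewrite (hp_initial _ _ _ _ P), cosh_0, sinh_0, Rmult_0_r, cos_0, sin_0.
    apply L3_ext; simpl; ring. }
  (* The initial frame is expressed by Q1, Q2, Q3 at (u, v); what remains is that the boost and
     rotation invert those that define them. *)
  intros u v H; rewrite <- Z1, <- Z2, <- Z3, <- (K1 u v H), <- (K2 u v H), <- (K3 u v H).
  assert (E1 := cosh_sqr (phi u)); assert (E2 := sin_cos_sqr (beta * v)).
  clear - E1 E2; split; apply L3_ext; simpl; ideal.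
Qed.

(** * Rigidity of the helicoid *)

Lemma differential_e1 (x : R -> R -> L3R) (u v : R) :
  differential x u v (1, 0) = d_u x u v.
Proof. apply L3R_ext; simpl; ring. Qed.

Lemma differential_e2 (x : R -> R -> L3R) (u v : R) :
  differential x u v (0, 1) = d_v x u v.
Proof. apply L3R_ext; simpl; ring. Qed.

(** This is the unit vector along p_v where sinh phi > 0 and beta > 0, but p_v vanishes at sinh phi
    = 0, so f is taken from the normal. The H^2-part of N has squared length 1 - nu^2 = 1 / phi'^2,
    whence the factor phi'; the sign gives p_v = beta sinh phi f. *)
Definition frame_f (phi : R -> R) (N : R -> R -> L3R) (u v : R) : L3 :=
  scale3 (- Derive phi u) (fst (N u v)).

Definition frame_e (phi : R -> R) (x : R -> R -> L3R) (u v : R) : L3 :=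
  scale3 (/ Derive phi u) (fst (d_u x u v)).

(** The identity dx(T) + nu N = d/dt, with T = (0, 1 / phi'^2), determines x_v completely from N;
    orthogonality then determines the height component of x_u. *)
Lemma helicoid_data_first_order (beta : R) (a b : Rbar) (phi : R -> R)
    (x N : R -> R -> L3R) (u v : R) :
  helicoid_profile beta a b phi ->
  conformal_minimal_immersion (strip a b) x N (helicoid_data beta phi) ->
  strip a b u v ->
  snd (d_u x u v) = 0 /\ snd (d_v x u v) = 1 /\
  fst (d_v x u v) = scale3 (beta * sinh (phi u)) (frame_f phi N u v) /\
  direct_frame (fst (x u v)) (frame_e phi x u v) (frame_f phi N u v).
Proof.
  intros P [I U HD _] H.
  assert (Lp := hp_increasing _ _ _ _ P u H).
  assert (F := hp_first _ _ _ _ P u H).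
  destruct (smooth_map_on_is_velocity _ x u v (ci_smooth _ _ I) H) as [Xu Xv].
  assert (Loc : locally u (fun s => lorentz (fst (x s v)) (fst (x s v)) = -1)).
  { apply (filter_imp (in_interval a b)); [ intros s Hs; now apply (ci_H2 _ _ I) | ].
    apply locally_in_interval, H. }
  assert (Hp := proj1 (ci_H2 _ _ I u v H)).
  assert (Hpu : lorentz (fst (x u v)) (fst (d_u x u v)) = 0).
  { assert (K := lorentz_constant_derive _ _ _ _ _ _ Loc (proj1 Xu) (proj1 Xu)).
    cbv beta in K; rewrite lorentz_sym in K; lra. }
  assert (Hg := has_metric _ _ _ _ HD u v (1, 0) (1, 0) H).
  assert (Ho := ci_orthogonal _ _ I u v H).
  assert (HN := un_normal _ _ _ U u v (1, 0) H).
  assert (Ht := un_tangent _ _ _ U u v H).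
  assert (H1 := un_unit _ _ _ U u v H).
  assert (Hd := un_direct _ _ _ U u v H).
  assert (Ha := has_angle _ _ _ _ HD u v H).
  assert (Hh := has_height _ _ _ _ HD u v H).
  rewrite !differential_e1 in *.
  cbn [helicoid_data metric angle height_field] in Hg, Ha, Hh; unfold differential in Hh.
  clear Xu Xv Loc I U HD.
  set (l := Derive phi u) in *.
  set (B := beta * sinh (phi u)) in *.
  rewrite <- Rpow_mult_distr in F; fold B in F.
  assert (R1 : / l * l = 1) by (field; lra).
  unfold frame_e, frame_f; fold l.
  set (r := / l) in *; clearbody r B l.
  destruct (x u v) as [p s], (d_u x u v) as [xu xu3], (d_v x u v) as [xv xv3],
    (N u v) as [n n3]; simpl in *.
  assert (En : n3 = B * r) by (rewrite Ha; unfold form, lorentz; simpl; ring).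
  clear Ha; subst n3.
  assert (Hh3 := f_equal snd Hh); simpl in Hh3.
  assert (E0 := f_equal (fun V => c0 (fst V)) Hh).
  assert (E1 := f_equal (fun V => c1 (fst V)) Hh).
  assert (E2 := f_equal (fun V => c2 (fst V)) Hh).
  simpl in E0, E1, E2; clear Hh.
  unfold tangent, form in *; simpl in *.
  (* The height component reads xv3 / l^2 + B^2 / l^2 = 1 with l^2 = 1 + B^2. *)
  assert (Ev3 : xv3 = 1) by (clear - F R1 Hh3; ideal).
  assert (Ev : xv = scale3 B (scale3 (- l) n))
    by (apply L3_ext; simpl; [ clear - R1 E0 | clear - R1 E1 | clear - R1 E2 ]; ideal).
  subst xv3 xv; clear E0 E1 E2.
  rewrite !lorentz_scale3_r in Ho.
  (* The relations <x_u, x_v> = 0 and <x_u, N> = 0 are linear in xu3 and <xu, n>; eliminating the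
     latter leaves xu3 (1 + B^2) = 0. *)
  assert (Eu3 : xu3 = 0).
  { assert (K : xu3 * (1 + B ^ 2) = 0) by (clear - Ho HN R1; ideal).
    destruct (Rmult_integral _ _ K); trivial.
    generalize (pow2_ge_0 B); lra. }
  subst xu3.
  split; [ | split; [ | split ] ]; trivial.
  apply direct_frame_intro; trivial; rewrite ?lorentz_scale3_r, ?lorentz_scale3_l,
    ?lorentz_scale3_r.
  - clear - Hg R1; ideal.
  - clear - H1 R1 F; ideal.
  - rewrite Hpu; ring.
  - rewrite lorentz_sym, Ht; ring.
  - assert (K : lorentz xu n = 0) by lra; rewrite K; ring.
  - replace (det3 p (scale3 r xu) (scale3 (- l) n)) with (- det3 p xu n)
      by (unfold det3; simpl; clear - R1; ideal).
    (* The choice of the direct unit normal thus makes the determinant of p, xu, n negative, and the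
       minus sign in f makes the frame direct. *)
    assert (E : det_tangent p (xu, 0) (scale3 B (scale3 (- l) n), 1) (n, B * r)
                = - det3 p xu n * l ^ 2)
      by (unfold det_tangent, det3; simpl; clear - R1 F; ideal).
    rewrite E in Hd; apply Rmult_lt_reg_r with (l ^ 2); [ | lra ].
    generalize (pow2_ge_0 B); lra.
Qed.

(** The equations for p come from the first-order data, those for f from the shape operator, and
    those for e from orthonormality. *)
Lemma helicoid_data_frame (beta : R) (a b : Rbar) (phi : R -> R) (x N : R -> R -> L3R) :
  helicoid_profile beta a b phi ->
  conformal_minimal_immersion (strip a b) x N (helicoid_data beta phi) ->
  helicoid_frame beta phi (strip a b)
    (fun u v => fst (x u v)) (frame_e phi x) (frame_f phi N).
Proof.
  intros P M.
  assert (FO := fun u v => helicoid_data_first_order beta a b phi x N u v P M).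
  assert (Lp := hp_increasing _ _ _ _ P).
  assert (Pu : forall u v, strip a b u v ->
    is_derive3 (fun s => fst (x s v)) u (scale3 (Derive phi u) (frame_e phi x u v))).
  { intros u v H; destruct (smooth_map_on_is_velocity _ x u v
      (ci_smooth _ _ (cmi_immersion _ _ _ _ M)) H) as [[Xu _] _].
    apply is_derive3_eq with (1 := Xu); specialize (Lp u H).
    apply L3_ext; unfold frame_e; simpl; field; lra. }
  assert (Pv : forall u v, strip a b u v ->
    is_derive3 (fun s => fst (x u s)) v
      (scale3 (beta * sinh (phi u)) (frame_f phi N u v))).
  { intros u v H; destruct (smooth_map_on_is_velocity _ x u v
      (ci_smooth _ _ (cmi_immersion _ _ _ _ M)) H) as [_ [Xv _]].
    apply is_derive3_eq with (1 := Xv); apply (FO u v H). }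
  (* The shape operator on d/du makes the H^2-part of N_u equal to - (phi'' / phi') times that of N,
     which is exactly what the factor phi' in f cancels. *)
  assert (Fu : forall u v, strip a b u v ->
    is_derive3 (fun s => frame_f phi N s v) u (mkL3 0 0 0)).
  { intros u v H; destruct (smooth_map_on_is_velocity _ N u v
      (un_smooth _ _ _ (cmi_normal _ _ _ _ M)) H) as [[Nu _] _].
    assert (Hs := has_shape _ _ _ _ (cmi_data _ _ _ _ M) u v (1, 0) H).
    apply (f_equal fst) in Hs; unfold nabla in Hs; rewrite differential_e1 in Hs.
    cbn [helicoid_data shape fst snd opp scale proj_tangent differential add] in Hs.
    assert (K : lorentz (fst (d_u N u v)) (fst (x u v)) = 0).
    { rewrite (lorentz_constant_derive (fun s => fst (N s v)) (fun s => fst (x s v))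
        u 0 _ _) with (2 := Nu) (3 := Pu u v H).
      - rewrite lorentz_scale3_r.
        assert (K := df_ef _ _ _ (proj2 (proj2 (proj2 (FO u v H))))).
        unfold frame_f in K; rewrite lorentz_scale3_r, lorentz_sym in K.
        lra.
      - apply (filter_imp (in_interval a b)); [ | apply locally_in_interval, H ].
        intros s Hs'; exact (un_tangent _ _ _ (cmi_normal _ _ _ _ M) s v Hs'). }
    rewrite K in Hs.
    destruct (FO u v H) as (_ & _ & Ev & _); rewrite Ev in Hs.
    eapply is_derive3_eq.
    - apply (is_derive3_scale3 (fun s => - Derive phi s) (fun s => fst (N s v))); [ | exact Nu ].
      apply (is_derive_opp (Derive phi)), (hp_second _ _ _ _ P u H).
    - specialize (Lp u H); assert (R1 : / Derive phi u * Derive phi u = 1) by (field; lra).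
      unfold frame_f in Hs.
      assert (E0 := f_equal c0 Hs); assert (E1 := f_equal c1 Hs);
        assert (E2 := f_equal c2 Hs); simpl in E0, E1, E2.
      set (r := / Derive phi u) in *; clearbody r.
      apply L3_ext; simpl; unfold opp; simpl;
        [ clear - R1 E0 | clear - R1 E1 | clear - R1 E2 ]; ideal. }
  (* The shape operator on d/dv gives the e-component. The p-component is the part normal to H^2
     that the projection removes; it is recovered from <N_v, p> = - <N, p_v>. *)
  assert (Fv : forall u v, strip a b u v ->
    is_derive3 (fun s => frame_f phi N u s) v
      (add3 (scale3 (beta * sinh (phi u)) (fst (x u v)))
            (scale3 (- (beta * cosh (phi u))) (frame_e phi x u v)))).
  { intros u v H; destruct (smooth_map_on_is_velocity _ N u v
      (un_smooth _ _ _ (cmi_normal _ _ _ _ M)) H) as [_ [Nv _]].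
    assert (Hs := has_shape _ _ _ _ (cmi_data _ _ _ _ M) u v (0, 1) H).
    apply (f_equal fst) in Hs; unfold nabla in Hs; rewrite differential_e2 in Hs.
    cbn [helicoid_data shape fst snd opp scale proj_tangent differential add] in Hs.
    assert (Lu := Lp u H); assert (R1 : / Derive phi u * Derive phi u = 1) by (field; lra).
    assert (K : lorentz (fst (d_v N u v)) (fst (x u v))
                = beta * sinh (phi u) * / Derive phi u).
    { rewrite (lorentz_constant_derive (fun s => fst (N u s)) (fun s => fst (x u s))
        v 0 _ _) with (2 := Nv) (3 := Pv u v H).
      - rewrite lorentz_scale3_r.
        assert (K := df_ff _ _ _ (proj2 (proj2 (proj2 (FO u v H))))).
        unfold frame_f in K |- *.
        rewrite lorentz_scale3_l, !lorentz_scale3_r in K.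
        rewrite !lorentz_scale3_r.
        set (r := / Derive phi u) in *; clearbody r; clear - K R1; ideal.
      - apply filter_forall; intros s.
        exact (un_tangent _ _ _ (cmi_normal _ _ _ _ M) u s H). }
    rewrite K in Hs.
    eapply is_derive3_eq.
    - apply (is_derive3_scale3 (fun _ => - Derive phi u) (fun s => fst (N u s)));
        [ apply is_derive_Rconst | exact Nv ].
    - unfold frame_e.
      assert (E0 := f_equal c0 Hs); assert (E1 := f_equal c1 Hs);
        assert (E2 := f_equal c2 Hs); simpl in E0, E1, E2.
      set (r := / Derive phi u) in *; clearbody r.
      apply L3_ext; simpl;
        [ clear - R1 E0 | clear - R1 E1 | clear - R1 E2 ]; ideal. }
  (* Existence of the derivatives of e suffices: their components along p and f are forced by the
     derivatives of p and f, and the one along e vanishes because <e, e> = 1. *)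
  assert (Ed : forall u v, strip a b u v -> exists eu ev,
    is_derive3 (fun s => frame_e phi x s v) u eu /\
    is_derive3 (fun s => frame_e phi x u s) v ev).
  { intros u v H; destruct (smooth_map_on_is_velocity _ (d_u x) u v
      (smooth_map_on_d_u _ _ (ci_smooth _ _ (cmi_immersion _ _ _ _ M))) H)
      as [[Du _] [Dv _]].
    specialize (Lp u H).
    do 2 eexists; split.
    - apply (is_derive3_scale3 (fun s => / Derive phi s) (fun s => fst (d_u x s v)));
        [ | exact Du ].
      apply (is_derive_inv (Derive phi)); [ apply (hp_second _ _ _ _ P u H) | lra ].
    - apply (is_derive3_scale3 (fun _ => / Derive phi u) (fun s => fst (d_u x u s)));
        [ apply is_derive_Rconst | exact Dv ]. }
  assert (Lu : forall (f g : R -> R -> L3) (k u v : R), strip a b u v ->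
    (forall s, in_interval a b s -> lorentz (f s v) (g s v) = k) ->
    locally u (fun s => lorentz (f s v) (g s v) = k)).
  { intros f g k u v H E; apply (filter_imp (in_interval a b)); trivial.
    apply locally_in_interval, H. }
  assert (FR : forall u v, strip a b u v ->
    direct_frame (fst (x u v)) (frame_e phi x u v) (frame_f phi N u v))
    by (intros u v H; apply (FO u v H)).
  split; trivial.
  - intros u v H; destruct (Ed u v H) as (eu & _ & De & _).
    apply is_derive3_eq with (1 := De).
    rewrite (frame_decomposition _ _ _ eu (FR u v H)).
    rewrite (lorentz_constant_derive (fun s => frame_e phi x s v)
      (fun s => fst (x s v)) u 0 _ _) with (2 := De) (3 := Pu u v H).
    2: { apply (Lu (frame_e phi x) (fun u v => fst (x u v))); trivial.
         intros s Hs; rewrite lorentz_sym; apply (FR s v Hs). }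
    rewrite (lorentz_constant_derive (fun s => frame_e phi x s v)
      (fun s => frame_f phi N s v) u 0 _ _) with (2 := De) (3 := Fu u v H).
    2: { apply (Lu (frame_e phi x) (frame_f phi N)); trivial.
         intros s Hs; apply (FR s v Hs). }
    assert (K := lorentz_constant_derive (fun s => frame_e phi x s v)
      (fun s => frame_e phi x s v) u 1 _ _
      (Lu (frame_e phi x) (frame_e phi x) 1 u v H
        (fun s Hs => df_ee _ _ _ (FR s v Hs))) De De).
    cbv beta in K; rewrite (lorentz_sym (frame_e phi x u v) eu) in K.
    replace (lorentz eu (frame_e phi x u v)) with 0 by lra.
    rewrite lorentz_scale3_r, (df_ee _ _ _ (FR u v H)).
    apply L3_ext; unfold lorentz; simpl; ring.
  - intros u v H; destruct (Ed u v H) as (_ & ev & _ & De).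
    apply is_derive3_eq with (1 := De).
    rewrite (frame_decomposition _ _ _ ev (FR u v H)).
    rewrite (lorentz_constant_derive (fun s => frame_e phi x u s)
      (fun s => fst (x u s)) v 0 _ _) with (2 := De) (3 := Pv u v H).
    2: { apply filter_forall; intros s; rewrite lorentz_sym; apply (FR u s H). }
    rewrite (lorentz_constant_derive (fun s => frame_e phi x u s)
      (fun s => frame_f phi N u s) v 0 _ _) with (2 := De) (3 := Fv u v H).
    2: { apply filter_forall; intros s; apply (FR u s H). }
    assert (L1 : locally v (fun s =>
      lorentz (frame_e phi x u s) (frame_e phi x u s) = 1))
      by (apply filter_forall; intros s; apply (FR u s H)).
    assert (K := lorentz_constant_derive (fun s => frame_e phi x u s)
      (fun s => frame_e phi x u s) v 1 _ _ L1 De De).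
    cbv beta in K; rewrite (lorentz_sym (frame_e phi x u v) ev) in K.
    replace (lorentz ev (frame_e phi x u v)) with 0 by lra.
    rewrite lorentz_scale3_r, (df_ef _ _ _ (FR u v H)).
    rewrite lorentz_sym, lorentz_add3_l, !lorentz_scale3_l.
    rewrite (df_pe _ _ _ (FR u v H)), (df_ee _ _ _ (FR u v H)).
    apply L3_ext; simpl; ring.
Qed.

(** At (0, 0) the frame of the helicoid is the standard basis and its height is 0. The isometry
    therefore reads coordinates in the initial frame of x and subtracts the initial height; the
    reparametrization is the identity. *)
Lemma helicoid_rigidity (beta : R) (a b : Rbar) (phi : R -> R) (x N : R -> R -> L3R) :
  helicoid_profile beta a b phi ->
  conformal_minimal_immersion (strip a b) x N (helicoid_data beta phi) ->
  same_surface (strip a b) x N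
    (strip a b) (helicoid beta phi) (helicoid_normal beta phi).
Proof.
  intros P M.
  assert (F := helicoid_data_frame beta a b phi x N P M).
  assert (FO := fun u v => helicoid_data_first_order beta a b phi x N u v P M).
  assert (I := hp_interval _ _ _ _ P).
  set (p := fun u v => fst (x u v)) in F.
  set (e := frame_e phi x) in F.
  set (f := frame_f phi N) in F.
  assert (Sol := helicoid_frame_solution beta a b phi p e f P F).
  assert (F0 : direct_frame (p 0 0) (e 0 0) (f 0 0)) by apply F, I.
  assert (Do := open2_strip a b).
  exists (fun u v => (u, v)), (fun u v => (u, v)),
    (frame_coordinates (p 0 0) (e 0 0) (f 0 0)), (- snd (x 0 0)).
  assert (Hz : forall u v, strip a b u v -> snd (x u v) - v = snd (x 0 0) - 0).
  { apply (constant_on_strip a b (fun u v => snd (x u v) - v)); trivial;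
      intros u v H;
      destruct (smooth_map_on_is_velocity _ x u v
        (ci_smooth _ _ (cmi_immersion _ _ _ _ M)) H) as [[_ Xu] [_ Xv]];
      destruct (FO u v H) as (Eu & Ev & _).
    - replace 0 with (snd (d_u x u v) - 0) by lra.
      now apply (is_derive_minus (fun s => snd (x s v)) (fun _ => v));
        [ | apply is_derive_Rconst ].
    - replace 0 with (snd (d_v x u v) - 1) by lra.
      now apply (is_derive_minus (fun s => snd (x u s)) (fun s => s));
        [ | apply is_derive_Rid ]. }
  assert (Co : forall y z t,
    frame_coordinates (p 0 0) (e 0 0) (f 0 0) (comb y z t (p 0 0) (e 0 0) (f 0 0))
    = mkL3 y z t).
  { intros y z t; unfold frame_coordinates, comb.
    rewrite !lorentz_add3_l, !lorentz_scale3_l.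
    rewrite (lorentz_sym (e 0 0) (p 0 0)), (lorentz_sym (f 0 0) (p 0 0)),
      (lorentz_sym (f 0 0) (e 0 0)).
    destruct F0 as [-> -> -> -> -> -> _]; apply L3_ext; simpl; ring. }
  split; [ | split; [ | split ] ].
  - split; simpl; trivial; try (now apply smooth_on_fst); now apply smooth_on_snd.
  - apply direct_isometry_frame_coordinates; trivial.
    exact (ci_H2 _ _ (cmi_immersion _ _ _ _ M) 0 0 I).
  - intros u v H; unfold isometry; simpl.
    destruct (Sol u v H) as [E _]; unfold p at 1 in E.
    rewrite E, Co; unfold helicoid; f_equal; generalize (Hz u v H); lra.
  - intros u v H; unfold isometry_differential; simpl.
    assert (L := hp_increasing _ _ _ _ P u H).
    destruct (Sol u v H) as [_ E].
    assert (EN : fst (N u v) = scale3 (- / Derive phi u) (f u v))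
      by (apply L3_ext; unfold f, frame_f; simpl; field; lra).
    (* The frame f only controls the H^2-part of N; its height component is the prescribed angle. *)
    assert (E3 := has_angle _ _ _ _ (cmi_data _ _ _ _ M) u v H).
    unfold form, lorentz in E3; simpl in E3.
    replace (fst (N u v)) with (comb 0 (/ Derive phi u * sin (beta * v))
      (- (/ Derive phi u * cos (beta * v))) (p 0 0) (e 0 0) (f 0 0))
      by (rewrite EN, E; apply L3_ext; simpl; ring).
    rewrite Co; apply L3R_ext; simpl; lra.
Qed.

(** * Uniqueness of the data and the conjugate data of the catenoid *)

(** The fields are total functions whose values off D are arbitrary, so data can only be compared
    pointwise on D. *)
Definition data_eq_on (D : R -> R -> Prop) (d d' : surface_data) : Prop :=
  forall u v, D u v ->
    (forall X Y, metric d u v X Y = metric d' u v X Y) /\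
    (forall X, shape d u v X = shape d' u v X) /\
    height_field d u v = height_field d' u v /\
    angle d u v = angle d' u v.

Lemma data_eq_on_trans (D : R -> R -> Prop) (d d' d'' : surface_data) :
  data_eq_on D d d' -> data_eq_on D d' d'' -> data_eq_on D d d''.
Proof.
  intros E E' u v H; destruct (E u v H) as (E1 & E2 & E3 & E4),
    (E' u v H) as (F1 & F2 & F3 & F4).
  repeat split; intros; congruence.
Qed.

Lemma data_eq_on_sym (D : R -> R -> Prop) (d d' : surface_data) :
  data_eq_on D d d' -> data_eq_on D d' d.
Proof.
  intros E u v H; destruct (E u v H) as (E1 & E2 & E3 & E4).
  repeat split; intros; congruence.
Qed.

Lemma conjugate_data_eq_on (D : R -> R -> Prop) (d d' : surface_data) :
  data_eq_on D d d' -> data_eq_on D (conjugate_data d) (conjugate_data d').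
Proof.
  intros E u v H; destruct (E u v H) as (E1 & E2 & E3 & E4).
  repeat split; simpl; intros; congruence.
Qed.

Lemma differential_inj (D : R -> R -> Prop) (x : R -> R -> L3R) (u v : R) (X Y : R * R) :
  conformal_immersion D x -> D u v ->
  differential x u v X = differential x u v Y -> X = Y.
Proof.
  intros I H E.
  assert (E1 : forall Z, form (differential x u v X) (differential x u v Z) =
                         form (differential x u v Y) (differential x u v Z))
    by (intros; now rewrite E).
  assert (Hu := E1 (1, 0)); assert (Hv := E1 (0, 1)).
  rewrite !form_differential, <- (ci_norms _ _ I u v H), (ci_orthogonal _ _ I u v H) in *.
  assert (L := ci_immersion _ _ I u v H); simpl in Hu, Hv.
  rewrite (surjective_pairing X), (surjective_pairing Y); f_equal;
    apply Rmult_eq_reg_r with (form (d_u x u v) (d_u x u v)); lra.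
Qed.

(** A conjugate immersion comes with some unspecified data of the catenoid; by injectivity of dx
    they coincide on D with the explicit ones. *)
Lemma has_data_unique (D : R -> R -> Prop) (x N : R -> R -> L3R) (d d' : surface_data) :
  conformal_immersion D x -> has_data D x N d -> has_data D x N d' -> data_eq_on D d d'.
Proof.
  intros I H1 H2 u v H; refine (conj _ (conj _ (conj _ _))).
  - intros; now rewrite (has_metric _ _ _ _ H1), (has_metric _ _ _ _ H2).
  - intros X; apply (differential_inj D x u v); trivial.
    now rewrite (has_shape _ _ _ _ H1), (has_shape _ _ _ _ H2).
  - apply (differential_inj D x u v); trivial.
    assert (E1 := has_height _ _ _ _ H1 u v H).
    rewrite <- (has_height _ _ _ _ H2 u v H) in E1.
    rewrite (has_angle _ _ _ _ H1), (has_angle _ _ _ _ H2) in E1 by trivial.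
    assert (F0 := f_equal (fun V => c0 (fst V)) E1).
    assert (F1 := f_equal (fun V => c1 (fst V)) E1).
    assert (F2 := f_equal (fun V => c2 (fst V)) E1).
    assert (F3 := f_equal snd E1).
    simpl in F0, F1, F2, F3; apply L3R_ext; simpl; lra.
  - now rewrite (has_angle _ _ _ _ H1), (has_angle _ _ _ _ H2).
Qed.

Lemma conformal_minimal_immersion_ext (D : R -> R -> Prop) (x N : R -> R -> L3R)
    (d d' : surface_data) :
  data_eq_on D d d' ->
  conformal_minimal_immersion D x N d -> conformal_minimal_immersion D x N d'.
Proof.
  intros E [I U [H1 H2 H3 H4] T]; split; trivial; [ split | ].
  - intros u v X Y H; destruct (E u v H) as (<- & _); auto.
  - intros u v X H; destruct (E u v H) as (_ & <- & _); auto.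
  - intros u v H; destruct (E u v H) as (_ & _ & _ & <-); auto.
  - intros u v H; destruct (E u v H) as (_ & _ & <- & <-); auto.
  - intros u v H; destruct (E u v H) as (_ & E2 & _); unfold trace.
    rewrite <- !E2; apply (T u v H).
Qed.

(** The profile relations hold with absolute values, while the surfaces and normals carry the signed
    parameters. The common sign s of alpha and beta cancels in pairs in the metric, T and the angle;
    for the shape operator it is needed that alpha cosh psi and beta cosh phi agree with their
    signs. *)
Lemma conjugate_catenoid_data (alpha beta : R) (a b : Rbar) (psi phi : R -> R) :
  0 < alpha * beta -> beta ^ 2 = 1 + alpha ^ 2 ->
  catenoid_profile alpha a b psi -> helicoid_profile beta a b phi ->
  (forall u, in_interval a b u ->
     Derive phi u = Rabs alpha * sinh (psi u) /\ Derive psi u = Rabs beta * sinh (phi u)) ->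
  data_eq_on (strip a b) (conjugate_data (catenoid_data alpha psi)) (helicoid_data beta phi).
Proof.
  intros AB E P Q K u v H; destruct (K u H) as [Ephi Epsi].
  assert (S := sinh_pos _ (cp_positive _ _ _ _ P u H)).
  assert (Cp := cosh_pos (psi u)); assert (Cf := cosh_pos (phi u)).
  assert (Ep := cosh_sqr (psi u)); assert (Ef := cosh_sqr (phi u)).
  assert (F := hp_first _ _ _ _ Q u H).
  assert (L := hp_increasing _ _ _ _ Q u H).
  assert (Sg : exists s : R, s * s = 1 /\ Rabs alpha = s * alpha /\ Rabs beta = s * beta).
  { destruct (Rle_lt_dec alpha 0) as [A | A].
    - exists (-1); rewrite !Rabs_left1 by nra; lra.
    - exists 1; rewrite !Rabs_right by nra; lra. }
  destruct Sg as (s & Hs & Ea & Eb); rewrite Ea in Ephi; rewrite Eb in Epsi.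
  assert (A0 : alpha <> 0) by (intros ->; lra).
  assert (s0 : s <> 0) by (intros ->; lra).
  assert (EC : alpha * cosh (psi u) = beta * cosh (phi u)).
  { assert (Sq : (alpha * cosh (psi u)) ^ 2 = (beta * cosh (phi u)) ^ 2).
    { rewrite Ephi in F; clear - F E Ep Ef Hs; ideal. }
    (* Equality of squares leaves two cases; alpha beta > 0 excludes the one with opposite signs. *)
    assert (Z : (alpha * cosh (psi u) - beta * cosh (phi u)) *
                (alpha * cosh (psi u) + beta * cosh (phi u)) = 0) by lra.
    destruct (Rmult_integral _ _ Z) as [Z' | Z']; [ lra | exfalso ].
    assert (Z2 : alpha * (alpha * cosh (psi u) + beta * cosh (phi u)) = 0)
      by (rewrite Z'; ring).
    assert (0 < alpha ^ 2) by now apply pow2_gt_0.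
    assert (0 < alpha ^ 2 * cosh (psi u)) by now apply Rmult_lt_0_compat.
    assert (0 < alpha * beta * cosh (phi u)) by now apply Rmult_lt_0_compat.
    lra. }
  assert (Er : / (alpha * sinh (psi u)) = s * / Derive phi u).
  { rewrite Ephi; field; repeat split; lra. }
  assert (Er2 : (/ (alpha * sinh (psi u))) ^ 2 = (/ Derive phi u) ^ 2).
  { rewrite Er; transitivity (s * s * (/ Derive phi u) ^ 2); [ ring | rewrite Hs; ring ]. }
  refine (conj _ (conj _ (conj _ _))); simpl.
  - intros X Y; rewrite Ephi.
    transitivity (s * s * (alpha * sinh (psi u)) ^ 2 * (fst X * fst Y + snd X * snd Y));
      [ rewrite Hs; ring | ring ].
  - intros X; simpl in Er2; rewrite Er2, EC; unfold J; simpl; f_equal; ring.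
  - simpl in Er2; rewrite Er2; unfold J; simpl; f_equal; ring.
  - rewrite Er, Epsi.
    transitivity (s * s * (beta * sinh (phi u) * / Derive phi u)); [ ring | rewrite Hs; ring ].
Qed.

Theorem proposition4p19 :
  forall (alpha beta : R),
    alpha <> 0 ->
    beta ^ 2 = 1 + alpha ^ 2 ->
    0 < alpha * beta ->
    forall (a b : Rbar) (psi : R -> R),
      maximal_solution (catenoid_profile alpha) a b psi ->
    forall (c d : Rbar) (phi : R -> R),
      maximal_solution (helicoid_profile beta) c d phi ->
      conjugate_surface
        (strip a b) (catenoid alpha psi) (catenoid_normal alpha psi)
        (strip c d) (helicoid beta phi) (helicoid_normal beta phi).
Proof.
  intros alpha beta A E AB a b psi MP c d phi MQ.
  assert (B : beta <> 0) by (intros ->; lra).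
  (* The profile problems, and hence maximality, depend on the parameters only through their
     squares, so the comparison of intervals can be made with positive parameters. *)
  assert (MP' : maximal_solution (catenoid_profile (Rabs alpha)) a b psi).
  { destruct MP as [P M]; split.
    - apply (catenoid_profile_sqr alpha); trivial; symmetry; apply pow2_abs.
    - intros a' b' g G; apply M, (catenoid_profile_sqr (Rabs alpha)); trivial.
      apply pow2_abs. }
  assert (MQ' : maximal_solution (helicoid_profile (Rabs beta)) c d phi).
  { destruct MQ as [Q M]; split.
    - apply (helicoid_profile_sqr beta); trivial; symmetry; apply pow2_abs.
    - intros a' b' g G; apply M, (helicoid_profile_sqr (Rabs beta)); trivial.
      apply pow2_abs. }
  destruct (maximal_profiles_dual (Rabs alpha) (Rabs beta) a b c d psi phi)
    as (-> & -> & K); trivial; try (now apply Rabs_pos_lt).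
  { now rewrite !pow2_abs. }
  destruct MP as [P _], MQ as [Q _].
  assert (Cat := catenoid_minimal alpha c d psi A P).
  assert (Conj := conjugate_catenoid_data alpha beta c d psi phi AB E P Q K).
  split.
  - exists (helicoid beta phi), (helicoid_normal beta phi), (catenoid_data alpha psi).
    split; trivial.
    apply (conformal_minimal_immersion_ext _ _ _ (helicoid_data beta phi)).
    + now apply data_eq_on_sym.
    + now apply helicoid_minimal.
  (* The given immersion has the conjugate of d0, some data of the catenoid. Uniqueness of data
     replaces d0 by [catenoid_data], whose conjugate is [helicoid_data], and rigidity applies. *)
  - intros x' N' (d0 & C0 & C').
    apply helicoid_rigidity; trivial.
    apply (conformal_minimal_immersion_ext _ _ _ (conjugate_data d0)); trivial.
    apply data_eq_on_trans with (2 := Conj), conjugate_data_eq_on.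
    apply (has_data_unique _ (catenoid alpha psi) (catenoid_normal alpha psi));
      [ apply Cat | apply C0 | apply Cat ].
Qed.
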